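(* Let $k\geq 2$ and $X>0$. Then \begin{equation*} \begin{split} N_k(X)=&\sum_{\substack{P \text{ odd, square-free}\\ P^{2^{k-1}}\leq X}} Q_k^{(1,1)}(P) + \sum_{\substack{P \text{ odd, square-free}\\ (4P)^{2^{k-1}}\leq X}} Q_k^{(3,1)}(P)\\ &+ \sum_{\substack{P \text{ odd, square-free}\\ (8P)^{2^{k-1}}\leq X}} Q_k^{(2,1)}(2P) + \sum_{\substack{P \text{ odd, square-free}\\ (16P)^{2^{k-1}}\leq X}} Q_k^{(2,3)}(2P), \end{split} \end{equation*} where all sums run over positive integers $P$.
   Context: A multi-quadratic number field of degree $2^k$ is a field $K=\mathbb{Q}(\sqrt{a_1},\ldots,\sqrt{a_k})$ with square-free integers $a_1,\ldots,a_k$ and $[K:\mathbb{Q}]=2^k$; the tuple $(a_1,\ldots,a_k)$ is called a presentation of $K$. $N_k(X)$ is the number of multi-quadratic number fields $K$ of degree $2^k$ whose discriminant satisfies $D(K)\leq X$. Every such field (with $k\geq 2$) has a presentation satisfying $(a_1,a_2)\equiv(1,1),(2,1),(3,1)$ or $(2,3)\pmod 4$ and $a_i\equiv 1\pmod 4$ for $i\geq 3$, and the residue class of $(a_1,a_2)$ in such a presentation is determined by $K$; $K$ is called an $(r,s)$-field if it has such a presentation with $(a_1,a_2)\equiv(r,s)\pmod 4$. For a nonzero integer $m$, $\mathrm{rad}(m)$ is the product of the distinct primes dividing $m$. For a square-free positive integer $m$, $Q_k^{(r,s)}(m)$ denotes the number of $(r,s)$-fields of degree $2^k$ having a presentation $(a_1,\ldots,a_k)$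 with $\mathrm{rad}(a_1\cdots a_k)=m$. *)

(* Defs.v *)
From HB Require Import structures.
From mathcomp Require Import all_boot all_order all_algebra all_field finmap.
From mathcomp Require Import boolp classical_sets functions cardinality fsbigop.
From mathcomp Require Import reals.

Set Implicit Arguments.
Unset Strict Implicit.
Unset Printing Implicit Defensive.

Import Order.TTheory GRing.Theory Num.Theory.

Local Open Scope classical_set_scope.
Local Open Scope ring_scope.

Definition squarefree (n : nat) : Prop :=
  forall d : nat, (d ^ 2 %| n)%N -> d = 1%N.

Definition rad (n : nat) : nat := (\prod_(p <- primes n) p)%N.

Section NumberField.
Variable L : fieldExtType rat.

(* The trace of y |-> x * y, read off the diagonal of its matrix in a basis. *)
Definition field_trace (x : L) : rat :=
  let b := vbasis {:L} in
  \sum_(i < \dim {:L}) coord b i (x * b`_i).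

Definition integral_basis (b : (\dim {:L}).-tuple L) : Prop :=
  basis_of {:L} b /\
  forall x : L, integralOver (intr : int -> L) x <->
    exists c : 'I_(\dim {:L}) -> int, x = \sum_(i < \dim {:L}) b`_i *~ c i.

Definition is_discriminant (d : int) : Prop :=
  exists2 b : (\dim {:L}).-tuple L, integral_basis b &
    d%:~R = \det (\matrix_(i < \dim {:L}, j < \dim {:L})
                    field_trace (b`_i * b`_j)).

End NumberField.

(* Number fields are counted as subfields of the algebraic numbers.  Degree and
   discriminant of such a K are those of a finite extension L of Q embedded with
   image K. *)

Definition adjoinQ (s : seq algC) : set algC :=
  smallest (fun K => divring_closed [in K]) [set` s].

Definition has_degree (K : set algC) (n : nat) : Prop :=
  exists (L : fieldExtType rat) (f : {rmorphism L -> algC}),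
    range f = K /\ \dim {:L} = n.

(* The discriminant is unique when it exists, which it does for a number field;
   0 is a default value. *)
Definition disc (K : set algC) : int :=
  xget 0 [set d | exists (L : fieldExtType rat) (f : {rmorphism L -> algC}),
                    range f = K /\ is_discriminant L d].

Definition presentation (k : nat) (K : set algC) (a : k.-tuple int) : Prop :=
  [/\ forall i : 'I_k, squarefree `|tnth a i|%N,
      K = adjoinQ [seq sqrtC (z%:~R : algC) | z <- a] &
      has_degree K (2 ^ k)%N].

Definition multiquadratic (k : nat) (K : set algC) : Prop :=
  exists a : k.-tuple int, presentation K a.

(* Indices are shifted: a`_0, a`_1 stand for a_1, a_2. *)
Definition rs_field (k : nat) (r s : int) (K : set algC) : Prop :=
  exists2 a : k.-tuple int, presentation K a &
    [/\ (a`_0 = r %[mod 4])%Z,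
        (a`_1 = s %[mod 4])%Z &
        forall i : nat, (2 <= i < k)%N -> (a`_i = 1 %[mod 4])%Z].

Definition bounded_fields (R : realType) (k : nat) (X : R) : set (set algC) :=
  [set K | multiquadratic k K /\ (disc K)%:~R <= X].

Definition rs_fields (k : nat) (r s : int) (m : nat) : set (set algC) :=
  [set K | rs_field k r s K /\
     exists2 a : k.-tuple int, presentation K a & rad `|(\prod_(z <- a) z)%R|%N = m].

(* #|` fset_set A| is the cardinality of A for finite A, and 0 otherwise. *)
Definition Nk (R : realType) (k : nat) (X : R) : nat :=
  #|` fset_set (bounded_fields k X)|%fset.

Definition Qk (k : nat) (r s : int) (m : nat) : nat :=
  #|` fset_set (rs_fields k r s m)|%fset.

Lemma squarefree_dvd_rad (n m : nat) :
  squarefree n -> (0 < m)%N -> (n %| m)%N -> (n %| rad m)%N.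
Proof.
move=> sqn m0 nm.
have n0 : (0 < n)%N by exact: dvdn_gt0 nm.
apply/dvdn_partP => // p; rewrite p_part mem_primes => /and3P[pp _ pn].
have -> : logn p n = 1%N.
  apply/eqP; rewrite eqn_leq logn_gt0 mem_primes pp n0 pn !andbT leqNgt.
  apply/negP; rewrite -pfactor_dvdn// => /sqn p1.
  by move: pp; rewrite p1.
have pm : p \in primes m by rewrite mem_primes pp m0 (dvdn_trans pn nm).
by rewrite /rad expn1 (big_rem p pm)/= dvdn_mulr.
Qed.

Lemma finite_rs_fields (k : nat) (r s : int) (m : nat) :
  finite_set (rs_fields k r s m).
Proof.
pose h (u : 'I_m.+1 * bool) : int := (-1) ^+ u.2 * (val u.1)%:Z.
pose F (l : seq int) : set algC := adjoinQ [seq sqrtC (z%:~R : algC) | z <- l].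
pose g (t : k.-tuple ('I_m.+1 * bool)) : set algC := F [seq h u | u <- t].
apply: (@sub_finite_set _ _ (range g)); last first.
  exact/finite_image/finite_finset.
move=> K [_ [a [sqa -> _] am]]; rewrite -/(F a).
have neq0 (z : int) : z \in (a : seq int) -> z != 0.
  move=> /tnthP[i ->]; apply/eqP => ai0.
  by have := sqa i; rewrite ai0 => /(_ 0%N (dvdnn _)).
have prod0 : (0 < `|(\prod_(z <- a) z)%R|)%N.
  by rewrite absz_gt0 prodf_seq_neq0; apply/allP => z /neq0.
have dvd (i : 'I_k) : (`|tnth a i| %| m)%N.
  rewrite -am; apply: squarefree_dvd_rad => //.
  by rewrite (big_rem _ (mem_tnth i a)) abszM; exact: dvdn_mulr.
have m0 : (0 < m)%N.
  rewrite -am /rad big_seq prodn_cond_gt0// => p.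
  by rewrite mem_primes => /andP[/prime_gt0].
pose t := [tuple (inord `|tnth a i| : 'I_m.+1, tnth a i < 0) | i < k].
have ta : [seq h u | u <- t] = a.
  rewrite /t /= -map_comp -[RHS](map_tnth_enum a); apply: eq_map => i.
  have le_m : (`|tnth a i| < m.+1)%N by rewrite ltnS; exact: dvdn_leq m0 (dvd i).
  rewrite /h /comp [LHS]/= (inordK le_m).
  exact/esym/intEsign.
by exists t; rewrite // /g ta.
Qed.

(* Main.v *)
Require Import Defs.
From HB Require Import structures.
From mathcomp Require Import all_boot all_order all_algebra all_field finmap.
From mathcomp Require Import boolp classical_sets functions cardinality fsbigop.
From mathcomp Require Import reals.
From mathcomp Require Import perm zify ring lra.

(* Let K = Q(r_1, ..., r_k) with r_i ^ 2 = a_i.  The products of the r_i, divided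
   by the largest possible integers, form a Q-basis e_s of square roots of
   squarefree integers c_s, orthogonal for the trace form, and every algebraic
   integer of K lies in 2^-k times their Z-span Lambda; so only the index of Lambda
   at 2 remains to be found.  If a_i = 1 mod 4 then x = y + z (1 + r_i) / 2 is
   integral at 2 iff y and z are, as (x - sigma x) / r_i = z for the conjugation
   sigma flipping r_i.  This strips all generators but the first one or two, and the
   remaining (bi)quadratic fields are treated by congruences mod 4.  The resulting
   2-local basis is corrected by Bezout into an integral basis that is triangular
   with respect to e_s, whence D(K) = (c rad(a_1 ... a_k)) ^ 2^(k-1) with c = 1, 4, 4, 8
   for the types (1,1), (3,1), (2,1), (2,3).  Types and radicals are therefore
   determined by the discriminant, and counting fields by discriminant is counting
   them by type and radical. *)

Set Implicit Arguments.
Unset Strict Implicit.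
Unset Printing Implicit Defensive.
Import Order.TTheory GRing.Theory Num.Theory.

Local Open Scope classical_set_scope.
Local Open Scope ring_scope.

Local Notation rad := Defs.rad.

(** * Integrality at 2 *)

(** The constant [c] is a count. On the [e_s] the trace form has determinant the product of the
    [2^k c_s], and the [c_s] multiply to [rad ^ 2^(k-1)] because a prime dividing some [a_i] divides
    [c_s] for exactly half of the [s]. Each factor [(1 + r_i) / 2] in a basis element gives back a
    4. A generator halved in all the [2^(k-1)] monomials containing it cancels its share [2^(2^k)];
    one that is never halved leaves [4 ^ 2^(k-1)]; the second generator of type (2,3) is halved only
    next to the first and leaves [2 ^ 2^(k-1)]. Hence 1, 4, 4 and 4 * 2. In the last two types the
    radical is [2 P], so the four bases are [P], [4 P], [8 P], [16 P] with [P] odd, told apart by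
    their power of 2. Bezout enters because products of the [r_i] and [(1 + r_i) / 2] are right at 2
    but may span too little at odd primes, while the [e_s] are right away from 2 only. *)

Lemma squarefree_gt0 n : squarefree n -> (0 < n)%N.
Proof. by move=> sf; rewrite lt0n; apply/eqP => n0; have := sf 0%N; rewrite n0 => /(_ isT). Qed.

Lemma squarefree_decompn m : (0 < m)%N ->
  exists g c : nat, [/\ (0 < g)%N, squarefree c & m = (g ^ 2 * c)%N].
Proof.
elim/ltn_ind: m => m IH m0; case: (pselect (squarefree m)) => [sf|].
  by exists 1%N, m; rewrite exp1n mul1n.
rewrite /squarefree => /existsNP[d /not_implyP[dm d1]].
have /dvdnP[q mE] := dm.
have d0 : (0 < d)%N by rewrite lt0n; apply/eqP => d0; rewrite mE d0 muln0 in m0.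
have q0 : (0 < q)%N by rewrite lt0n; apply/eqP => q0; rewrite mE q0 in m0.
have [|//|g [c [g0 sf qE]]] := IH q; first by rewrite mE; nia.
exists (d * g)%N, c; split=> //; first by rewrite muln_gt0 d0.
by rewrite mE qE; lia.
Qed.

Lemma squarefree_decomp (n : int) : n != 0 ->
  exists (g : nat) (c : int), [/\ (0 < g)%N, squarefree `|c|%N & n = g%:Z ^+ 2 * c].
Proof.
rewrite -absz_gt0 => /squarefree_decompn[g [c [g0 sf nE]]].
exists g, ((-1) ^+ (n < 0)%R * c%:Z); split=> //; first by rewrite abszMsign.
by rewrite {1}[n]intEsign nE PoszM -[in LHS]natz natrX natz mulrCA.
Qed.

Lemma rat_fracE (q : rat) : q * (denq q)%:~R = (numq q)%:~R.
Proof. by rewrite -{1}[q]divq_num_den divfK // intr_eq0 denq_eq0. Qed.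

(** The square of the denominator is prime to that of the numerator, so it divides [c] and must be
    1. *)
Lemma int_of_sqr_mul_squarefree (q : rat) (c : int) :
  squarefree `|c|%N -> q ^+ 2 * c%:~R \is a Num.int -> q \is a Num.int.
Proof.
move=> sf /intrP[z zE].
have : numq q ^+ 2 * c = z * denq q ^+ 2.
  by apply: (@intr_inj rat); rewrite !intrM -zE -rat_fracE; ring.
move/(congr1 absz); rewrite abszM [in RHS]abszM !abszX => E.
have /sf d1 : (`|denq q| ^ 2 %| `|c|)%N.
  have cp : coprime (`|denq q| ^ 2) (`|numq q| ^ 2).
    by rewrite coprimeXl // coprimeXr // coprime_sym coprime_num_den.
  by rewrite -(Gauss_dvdr _ cp) E; exact: dvdn_mull.
rewrite Qint_def; have := denq_gt0 q; move: d1; lia.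
Qed.

(* [x] becomes a member of [P] after multiplication by an odd integer: for the
   integers inside [rat] this is the localization at 2. *)
Definition up_to_odd (V : nmodType) (P : V -> Prop) (x : V) : Prop :=
  exists2 n : nat, odd n & P (x *+ n).

Definition int2 : rat -> Prop := up_to_odd (fun q : rat => q \is a Num.int).

Section UpToOdd.
Variables (R : pzRingType) (P : R -> Prop).
Hypothesis PB : forall x y, P x -> P y -> P (x - y).
Hypothesis PM : forall x y, P x -> P y -> P (x * y).

Lemma closed0 x : P x -> P 0.
Proof. by move=> Px; have := PB Px Px; rewrite subrr. Qed.

Lemma closedD x y : P x -> P y -> P (x + y).
Proof.
move=> Px Py; rewrite -[y]opprK; apply: PB => //; rewrite -sub0r; apply: PB => //.
exact: closed0 Px.
Qed.

Lemma closedMn x n : P x -> P (x *+ n).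
Proof.
move=> Px; elim: n => [|n IH]; rewrite ?mulr0n ?mulrS; first exact: closed0 Px.
exact: closedD.
Qed.

Lemma up_to_oddW x : P x -> up_to_odd P x.
Proof. by move=> Px; exists 1%N. Qed.

Lemma up_to_oddB x y : up_to_odd P x -> up_to_odd P y -> up_to_odd P (x - y).
Proof.
move=> [n on Pn] [m om Pm]; exists (n * m)%N; first by rewrite oddM on.
rewrite mulrnBl; apply: PB; first by rewrite mulrnA; exact: closedMn.
by rewrite mulnC mulrnA; exact: closedMn.
Qed.

Lemma up_to_oddM x y : up_to_odd P x -> up_to_odd P y -> up_to_odd P (x * y).
Proof.
move=> [n on Pn] [m om Pm]; exists (n * m)%N; first by rewrite oddM on.
by rewrite mulrnA -mulrnAl -mulrnAr; exact: PM.
Qed.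

Lemma up_to_oddD x y : up_to_odd P x -> up_to_odd P y -> up_to_odd P (x + y).
Proof.
move=> Px Py; rewrite -[y]opprK; apply: up_to_oddB => //; rewrite -sub0r; apply: up_to_oddB => //.
by case: Px => n _ /closed0; exact: up_to_oddW.
Qed.

Lemma up_to_oddMn x n : odd n -> up_to_odd P (x *+ n) -> up_to_odd P x.
Proof. by move=> on [m om]; rewrite -mulrnA; exists (n * m)%N; rewrite ?oddM ?on. Qed.
End UpToOdd.

Lemma int2_of_odd_denq (q : rat) : odd `|denq q|%N -> int2 q.
Proof.
move=> od; exists `|denq q|%N => //; rewrite -mulr_natr.
have -> : `|denq q|%:R = (denq q)%:~R :> rat by rewrite natr_absz gtr0_norm ?denq_gt0.
by rewrite rat_fracE intr_int.
Qed.

Lemma dvd4_of_odd_mul (n t : int) : odd `|n|%N -> (4 %| t * n)%Z -> (4 %| t)%Z.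
Proof.
move=> on; rewrite Gauss_dvdzl // coprimezE.
by rewrite (_ : absz 4 = (2 ^ 2)%N) // coprimeXl // coprime2n.
Qed.

(** An even denominator comes with an odd numerator; after clearing denominators the factor 4 of its
    square could only divide [m]. *)
Lemma int2_of_sqr_mul (q : rat) (m : int) :
  ~~ (4 %| m)%Z -> int2 (q ^+ 2 * m%:~R) -> int2 q.
Proof.
move=> m4 [n on /intrP[z zE]]; apply: int2_of_odd_denq; rewrite -[odd _]negbK; apply/negP => ed.
have : numq q ^+ 2 * m * n%:Z = z * denq q ^+ 2.
  by apply: (@intr_inj rat); rewrite !intrM -zE -rat_fracE -mulr_natr; ring.
have := coprime_num_den q.
have on1 : odd `|numq q|%N.
  apply: contraT => en; have : (2 %| gcdn `|numq q| `|denq q|)%N by rewrite dvdn_gcd !dvdn2 en ed.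
  by move: (coprime_num_den q); rewrite /coprime => /eqP ->.
move=> _; set u := numq q in on1 *; set d := denq q in ed *.
have [d' ->] : exists d', d = 2 * d' by exists (d %/ 2)%Z; lia.
have [u' ->] : exists u', u = 2 * u' + 1 by exists (u %/ 2)%Z; lia.
have [n' ->] : exists n' : nat, n = (2 * n' + 1)%N by exists (n %/ 2)%N; lia.
move=> E; move/negP: m4; apply; apply: (@dvd4_of_odd_mul ((2 * u' + 1) ^+ 2 * (2 * n' + 1)%N%:Z)).
  by rewrite abszM abszX oddM oddX /=; lia.
by apply/dvdzP; exists (z * d' ^+ 2); rewrite mulrA [m * _]mulrC E; ring.
Qed.

Lemma int2P (q : rat) : int2 q -> exists (n : nat) (z : int), odd n /\ q * n%:R = z%:~R.
Proof. by case=> n on /intrP[z zE]; exists n, z; rewrite mulr_natr. Qed.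

Lemma int2_half (q : rat) (n : nat) (z : int) : odd n -> 2 * q * n%:R = z%:~R ->
  (2 %| z)%Z -> int2 q.
Proof.
move=> on E /dvdzP[w wE]; exists n => //; apply/intrP; exists w.
by apply: (@mulfI rat 2) => //; rewrite -[q *+ n]mulr_natr mulrA E wE intrM mulrC.
Qed.

(* The ring of integers of Q_2(sqrt m) is Z_2[sqrt m] when m = 2, 3 mod 4. *)
Lemma int2_quadratic (p q : rat) (m : int) : (m %% 4)%Z = 2 \/ (m %% 4)%Z = 3 ->
  int2 (2 * p) -> int2 ((2 * q) ^+ 2 * m%:~R) -> int2 (p ^+ 2 - m%:~R * q ^+ 2) ->
  int2 p /\ int2 q.
Proof.
move=> m4 Hp /int2_of_sqr_mul Hq N.
have {}Hq : int2 (2 * q) by apply: Hq; lia.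
have [np [A [onp Ap]]] := int2P Hp; have [nq [B [onq Bq]]] := int2P Hq.
have [nn [C [onn Cn]]] := int2P N.
pose n := (np * nq)%N; have on : odd n by rewrite oddM onp.
have {Ap} Ap : 2 * p * n%:R = (A * nq%:Z)%:~R.
  by rewrite /n natrM intrM mulrA Ap.
have {Bq} Bq : 2 * q * n%:R = (B * np%:Z)%:~R.
  by rewrite /n mulnC natrM intrM mulrA Bq.
move: (A * _) (B * _) Ap Bq => {}A {}B Ap Bq.
have E : (A ^+ 2 - m * B ^+ 2) * nn%:Z = 4 * (C * n%:Z ^+ 2).
  apply: (@intr_inj rat); rewrite intrM intrB !(intrM, rmorphXn) /= -Ap -Bq -Cn; ring.
have {}E : (4 %| (A ^+ 2 - m * B ^+ 2) * nn%:Z)%Z by rewrite E dvdz_mulr.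
have /dvdzP[w wE] := dvd4_of_odd_mul (onn : odd `|nn%:Z|%N) E.
(* [A] and [B] are the doubled coordinates over the odd common denominator [n]. If one of them were
   odd, [A^2 - m B^2] would be 1, [-m] or [1 - m] modulo 4, none of which is 0 for m = 2, 3. *)
suff [dA dB] : (2 %| A)%Z /\ (2 %| B)%Z.
  by split; [exact: int2_half Ap dA|exact: int2_half Bq dB].
clear - m4 wE.
have [t [e [mE He]]] : exists t e, m = 4 * t + e /\ (e = 2 \/ e = 3).
  by exists (m %/ 4)%Z, (m %% 4)%Z; lia.
have P2 (z : int) : exists x e, z = 2 * x + e /\ (e = 0 \/ e = 1).
  by exists (z %/ 2)%Z, (z %% 2)%Z; lia.
have [xA [eA [AE HA]]] := P2 A; have [xB [eB [BE HB]]] := P2 B.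
rewrite {}mE {}AE {}BE {m4} in wE *.
by case: HA wE => ->; case: HB => ->; case: He => -> wE; split; lia.
Qed.

(* The ring of integers of Q_2(sqrt a0, sqrt a1), (a0, a1) = (2, 3) mod 4. *)
Lemma int2_biquadratic (y0 y1 z0 z1 : rat) (a0 a1 : int) :
  (a0 %% 4)%Z = 2 -> (a1 %% 4)%Z = 3 ->
  int2 (2 * y0) -> int2 (2 * y1) -> int2 (2 * z0) -> int2 (2 * z1) ->
  int2 (y0 ^+ 2 + a1%:~R * y1 ^+ 2 - a0%:~R * (z0 ^+ 2 + a1%:~R * z1 ^+ 2)) ->
  int2 (2 * (y0 * y1 - a0%:~R * (z0 * z1))) ->
  [/\ int2 y0, int2 y1 & int2 (z0 - z1)].
Proof.
move=> h0 h1 /int2P[n1 [A [o1 A1]]] /int2P[n2 [B [o2 B2]]] /int2P[n3 [C [o3 C3]]].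
move=> /int2P[n4 [D [o4 D4]]] /int2P[n5 [F [o5 F5]]] /int2P[n6 [G [o6 G6]]].
pose n := (n1 * n2 * n3 * n4)%N; have on : odd n by rewrite !oddM o1 o2 o3.
have {A1} A1 : 2 * y0 * n%:R = (A * (n2 * n3 * n4)%N)%:~R.
  by rewrite /n intrM -A1 !natrM -pmulrn !natrM; ring.
have {B2} B2 : 2 * y1 * n%:R = (B * (n1 * n3 * n4)%N)%:~R.
  by rewrite /n intrM -B2 !natrM -pmulrn !natrM; ring.
have {C3} C3 : 2 * z0 * n%:R = (C * (n1 * n2 * n4)%N)%:~R.
  by rewrite /n intrM -C3 !natrM -pmulrn !natrM; ring.
have {D4} D4 : 2 * z1 * n%:R = (D * (n1 * n2 * n3)%N)%:~R.
  by rewrite /n intrM -D4 !natrM -pmulrn !natrM; ring.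
move: (A * _) (B * _) (C * _) (D * _) A1 B2 C3 D4 => {}A {}B {}C {}D A1 B2 C3 D4.
have E1 : (A ^+ 2 + a1 * B ^+ 2 - a0 * (C ^+ 2 + a1 * D ^+ 2)) * n5%:Z = 4 * (F * n%:Z ^+ 2).
  apply: (@intr_inj rat); rewrite !(intrM, intrB, intrD, rmorphXn) /= -A1 -B2 -C3 -D4 -F5; ring.
have E2 : (2 * (A * B - a0 * (C * D))) * n6%:Z = 4 * (G * n%:Z ^+ 2).
  apply: (@intr_inj rat); rewrite !(intrM, intrB, intrD, rmorphXn) /= -A1 -B2 -C3 -D4 -G6; ring.
have /dvdzP[w1 W1] : (4 %| A ^+ 2 + a1 * B ^+ 2 - a0 * (C ^+ 2 + a1 * D ^+ 2))%Z.
  by apply: (@dvd4_of_odd_mul n5) => //; rewrite E1 dvdz_mulr.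
have /dvdzP[w2 W2] : (4 %| 2 * (A * B - a0 * (C * D)))%Z.
  by apply: (@dvd4_of_odd_mul n6) => //; rewrite E2 dvdz_mulr.
have CD : 2 * (z0 - z1) * n%:R = (C - D)%:~R by rewrite intrB -C3 -D4; ring.
(* Modulo 4 the first relation reads [A^2 - B^2 - 2 (C^2 - D^2) = 0], which forces [A = B] and then
   [C = D] modulo 2. As [a0] is even, the second one makes [A B] even, so [A] and [B] are both
   even. *)
suff [dA dB dC] : [/\ (2 %| A)%Z, (2 %| B)%Z & (2 %| C - D)%Z].
  by split; [exact: int2_half A1 dA|exact: int2_half B2 dB|exact: int2_half CD dC].
clear - h0 h1 W1 W2.
have [t0 E0] : exists t, a0 = 4 * t + 2 by exists (a0 %/ 4)%Z; lia.
have [t1 E1] : exists t, a1 = 4 * t + 3 by exists (a1 %/ 4)%Z; lia.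
have P2 (z : int) : exists x e, z = 2 * x + e /\ (e = 0 \/ e = 1).
  by exists (z %/ 2)%Z, (z %% 2)%Z; lia.
have [xA [eA [AE HA]]] := P2 A; have [xB [eB [BE HB]]] := P2 B.
have [xC [eC [CE HC]]] := P2 C; have [xD [eD [DE HD]]] := P2 D.
rewrite {}E0 {}E1 {}AE {}BE {}CE {}DE {h0 h1} in W1 W2 *.
by case: HA W1 W2 => ->; case: HB => ->; case: HC => ->; case: HD => -> W1 W2; split; lia.
Qed.

(** * Integral elements and the trace form *)

Notation integralZ L := (integralOver (intr : int -> L)).

Lemma integralZ_rmorph (L : fieldExtType rat) (f : {rmorphism L -> L}) x :
  integralZ L x -> integralZ L (f x).
Proof.
move/(integral_rmorph f); congr integralOver.
by apply/funext => z /=; rewrite rmorph_int.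
Qed.

Lemma integralZ_sqrt (L : fieldExtType rat) x : integralZ L (x ^+ 2) -> integralZ L x.
Proof.
move=> ix; apply: (@integral_root_monic _ _ _ _ ('X^2 - (x ^+ 2)%:P)).
- by rewrite monicXnsubC.
- by rewrite rootE !hornerE subrr.
- apply/integral_poly => -[|[|[|i]]]; rewrite !coefE /= ?sub0r ?subr0.
  + exact: integral_opp.
  + by rewrite oppr0; exact: integral0.
  + exact: integral1.
  + by rewrite oppr0; exact: integral0.
Qed.

(** The monic equation is carried from [L] down to [rat] and up to [algC], where rational algebraic
    integers are integers. *)
Lemma integralZ_alg (L : fieldExtType rat) (q : rat) :
  integralZ L q%:A -> q \is a Num.int.
Proof.
move=> [p pm rp].
have {}rp : root (map_poly intr p : {poly rat}) q.
  rewrite -(fmorph_root (in_alg L)) -map_poly_comp /=; move: rp; congr root.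
  by apply: eq_map_poly => z /=; rewrite scaler_int.
have Aq : (ratr q : algC) \in Aint.
  apply: (@root_monic_Aint (map_poly intr p)).
  - move: rp; rewrite -(fmorph_root (ratr : rat -> algC)) -map_poly_comp /=; congr root.
    by apply: eq_map_poly => z /=; rewrite ratr_int.
  - exact: monic_map.
  - by apply/polyOverP => i; rewrite coef_map /= intr_int.
have /intrP[z zE] := Cint_rat_Aint (Crat_rat q) Aq.
apply/intrP; exists z; apply: (fmorph_inj (ratr : {rmorphism rat -> algC})).
by rewrite rmorph_int.
Qed.

Section TraceForm.
Variable L : fieldExtType rat.

Lemma field_traceD (x y : L) : field_trace (x + y) = field_trace x + field_trace y.
Proof.
rewrite /field_trace -big_split; apply: eq_bigr => i _.
by rewrite mulrDl linearD.
Qed.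

Lemma field_traceZ c (x : L) : field_trace (c *: x) = c * field_trace x.
Proof.
rewrite /field_trace mulr_sumr; apply: eq_bigr => i _.
by rewrite -scalerAl linearZ.
Qed.

Lemma field_trace_sum (I : finType) (F : I -> L) :
  field_trace (\sum_i F i) = \sum_i field_trace (F i).
Proof.
apply: (big_morph _ field_traceD).
by rewrite -(scale0r 0) field_traceZ mul0r.
Qed.

Definition trace_gram n (b : 'I_n -> L) : 'M[rat]_n :=
  \matrix_(i, j) field_trace (b i * b j).

Lemma det_trace_gram_change n (b e : 'I_n -> L) (C : 'M[rat]_n) :
  (forall i, b i = \sum_j C i j *: e j) ->
  \det (trace_gram b) = \det C ^+ 2 * \det (trace_gram e).
Proof.
move=> bE; suff -> : trace_gram b = C *m trace_gram e *m C^T.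
  by rewrite !det_mulmx det_tr; ring.
apply/matrixP => i j; rewrite !mxE [in LHS]bE [in LHS](bE j).
rewrite mulr_suml field_trace_sum.
under eq_bigr => u _ do rewrite mulr_sumr field_trace_sum.
rewrite exchange_big; apply: eq_bigr => v _; rewrite !mxE mulr_suml.
apply: eq_bigr => u _; rewrite !mxE -scalerAl -scalerAr !field_traceZ; ring.
Qed.

(** Each integral basis is an integral combination of the other, so [d] and [d'] are multiples of
    each other by squares of integers; unless both vanish, these squares are 1. *)
Lemma discriminant_unique d d' : is_discriminant L d -> is_discriminant L d' -> d = d'.
Proof.
have key (b b' : (\dim {:L}).-tuple L) : integral_basis b -> integral_basis b' ->
    exists z : int, \det (trace_gram (fun i : 'I_(\dim {:L}) => b`_i)) =
      z%:~R ^+ 2 * \det (trace_gram (fun i : 'I_(\dim {:L}) => b'`_i)) :> rat.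
  move=> [_ ib] [_ ib'].
  have /choice[c cE] : forall i : 'I_(\dim {:L}), exists c : 'I_(\dim {:L}) -> int,
      b`_i = \sum_(j < \dim {:L}) b'`_j *~ c j.
    move=> i; apply/ib'/ib; exists (fun j => (j == i)%:Z).
    by rewrite (bigD1 i) //= eqxx big1 ?addr0 // => j /negbTE ->.
  exists (\det (\matrix_(i, j) c i j)).
  rewrite (@det_trace_gram_change _ _ (fun i => b'`_i) (\matrix_(i, j) (c i j)%:~R)).
    congr (_ ^+ 2 * _); rewrite -(det_map_mx (intr : int -> rat)); congr determinant.
    by apply/matrixP => i j; rewrite !mxE.
  move=> i; rewrite [LHS]cE; apply: eq_bigr => j _.
  by rewrite mxE scaler_int.
move=> [b ib dE] [b' ib' dE'].
have [z zE] := key _ _ ib ib'; have [w wE] := key _ _ ib' ib.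
rewrite -/(trace_gram _) in dE dE'; rewrite -dE -dE' in zE wE.
have {}zE : d = z ^+ 2 * d' by apply: (@intr_inj rat); rewrite zE intrM rmorphXn.
have {}wE : d' = w ^+ 2 * d by apply: (@intr_inj rat); rewrite wE intrM rmorphXn.
have [d0|d0] := eqVneq d 0; first by rewrite wE d0 mulr0.
have : (z * w) ^+ 2 = 1.
  by apply: (mulIf d0); rewrite mul1r [RHS]zE [d' in RHS]wE; ring.
move=> /eqP; rewrite sqrf_eq1 => /orP zw.
have z1 : `|z|%N = 1%N.
  by case: zw => /eqP/(congr1 absz); rewrite abszM => /eqP; rewrite muln_eq1 => /andP[/eqP].
have zz : z = 1 \/ z = -1 by lia.
by rewrite zE; case: zz => ->; rewrite ?sqrrN expr1n mul1r.
Qed.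

End TraceForm.

(** * Triangular integral bases *)

Section Coordinates.
Variables (L : fieldExtType rat) (G : finType).
Implicit Types (e b : G -> L).

(** Bases are indexed by a finite type, since the monomials are naturally indexed by exponent
    vectors; the tuple is only the interface to [coord] and [basis_of]. *)
Definition family_tuple e : #|G|.-tuple L := [tuple e (enum_val i) | i < #|G|].

Definition coeff e (s : G) (x : L) : rat := coord (family_tuple e) (enum_rank s) x.

Lemma coeffD e s x y : coeff e s (x + y) = coeff e s x + coeff e s y.
Proof. exact: linearD. Qed.

Lemma coeffB e s x y : coeff e s (x - y) = coeff e s x - coeff e s y.
Proof. exact: linearB. Qed.

Lemma coeffZ e s c x : coeff e s (c *: x) = c * coeff e s x.
Proof. exact: linearZ. Qed.

Lemma coeff_sum e s (I : finType) (F : I -> L) :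
  coeff e s (\sum_i F i) = \sum_i coeff e s (F i).
Proof. exact: linear_sum. Qed.

Lemma family_tupleE e (i : 'I_#|G|) : (family_tuple e)`_i = e (enum_val i).
Proof. by rewrite -tnth_nth tnth_mktuple. Qed.

Lemma coeffK e x : basis_of {:L} (family_tuple e) -> x = \sum_s coeff e s x *: e s.
Proof.
move=> eb; rewrite {1}(coord_basis eb (memvf x)) [RHS]big_enum_val /=.
by apply: eq_bigr => i _; rewrite family_tupleE /coeff enum_valK.
Qed.

Lemma coeff_basis e s t : basis_of {:L} (family_tuple e) -> coeff e s (e t) = (s == t)%:R.
Proof.
move=> eb; have <- : (family_tuple e)`_(enum_rank t) = e t by rewrite family_tupleE enum_rankK.
by rewrite /coeff coord_free ?(basis_free eb) // (inj_eq enum_rank_inj) eq_sym.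
Qed.

Lemma coeff_comb e c s : basis_of {:L} (family_tuple e) ->
  coeff e s (\sum_t c t *: e t) = c s.
Proof.
move=> eb; rewrite coeff_sum (bigD1 s) //= coeffZ coeff_basis // eqxx mulr1 big1 ?addr0 //.
by move=> t ts; rewrite coeffZ coeff_basis // eq_sym (negbTE ts) mulr0.
Qed.

Lemma family_basis e : \dim {:L} = #|G| ->
  (forall x, exists c : G -> rat, x = \sum_s c s *: e s) -> basis_of {:L} (family_tuple e).
Proof.
move=> dL sp; rewrite basisEdim size_tuple dL leqnn andbT.
apply/subvP => x _; have [c ->] := sp x.
apply: memv_suml => s _; apply: memvZ; apply: memv_span.
by apply/tnthP; exists (enum_rank s); rewrite tnth_mktuple enum_rankK.
Qed.

(** Basis independence of the trace: expanding each basis in the other one gives the same multiple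
    sum. It allows traces to be computed on monomials although [field_trace] is defined with
    [vbasis]. *)
Lemma field_trace_coeff e x : basis_of {:L} (family_tuple e) ->
  field_trace x = \sum_s coeff e s (x * e s).
Proof.
move=> eb; rewrite /field_trace; set v := vbasis _.
have vb : basis_of {:L} v by exact: vbasisP.
transitivity (\sum_(i < \dim {:L}) \sum_s \sum_t
    coeff e s v`_i * (coeff e t (x * e s) * coord v i (e t))).
  apply: eq_bigr => i _; rewrite {1}(coeffK v`_i eb) mulr_sumr linear_sum.
  apply: eq_bigr => s _; rewrite -scalerAr linearZ /= {1}(coeffK (x * e s) eb) linear_sum mulr_sumr.
  by apply: eq_bigr => t _; rewrite linearZ.
rewrite exchange_big; apply: eq_bigr => s _.
rewrite exchange_big /= [RHS](_ : _ = \sum_t (t == s)%:R * coeff e t (x * e s)); last first.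
  by rewrite (bigD1 s) //= eqxx mul1r big1 ?addr0 // => t /negbTE ->; rewrite mul0r.
apply: eq_bigr => t _; rewrite eq_sym -(coeff_basis s t eb) {2}(coord_basis vb (memvf (e t))).
rewrite coeff_sum mulr_suml; apply: eq_bigr => i _; rewrite coeffZ; ring.
Qed.

Definition Zspan b (x : L) : Prop := exists c : G -> int, x = \sum_s (c s)%:~R *: b s.

Lemma Zspan_gen b s : Zspan b (b s).
Proof.
exists (fun t => (t == s)%:Z); rewrite (bigD1 s) //= eqxx scale1r big1 ?addr0 // => t /negbTE ->.
by rewrite scale0r.
Qed.

Lemma ZspanD b x y : Zspan b x -> Zspan b y -> Zspan b (x + y).
Proof.
move=> [c ->] [d ->]; exists (fun s => c s + d s); rewrite -big_split.
by apply: eq_bigr => s _; rewrite intrD scalerDl.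
Qed.

Lemma ZspanZ b (z : int) x : Zspan b x -> Zspan b (z%:~R *: x).
Proof.
move=> [c ->]; exists (fun s => z * c s); rewrite scaler_sumr.
by apply: eq_bigr => s _; rewrite intrM scalerA.
Qed.

Lemma ZspanB b x y : Zspan b x -> Zspan b y -> Zspan b (x - y).
Proof. by move=> xb yb; apply: ZspanD => //; rewrite -scaleN1r; exact: (@ZspanZ _ (-1)). Qed.

Lemma Zspan_sum b (I : finType) (P : pred I) (F : I -> L) :
  (forall i, P i -> Zspan b (F i)) -> Zspan b (\sum_(i | P i) F i).
Proof.
move=> FP; apply: big_ind => //; last exact: ZspanD.
by exists (fun=> 0); rewrite big1 // => s _; rewrite scale0r.
Qed.

Lemma Zspan_trans b e x : (forall s, Zspan b (e s)) -> Zspan e x -> Zspan b x.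
Proof. by move=> eb [c ->]; apply: Zspan_sum => s _; exact: ZspanZ. Qed.

(** A Bezout combination, which glues the information at 2 with that away from 2. *)
Lemma Zspan_coprime b (m n : nat) x : coprime m n ->
  Zspan b (m%:R *: x) -> Zspan b (n%:R *: x) -> Zspan b x.
Proof.
move=> cmn mx nx; have /coprimezP[[u v] /= uv] : coprimez m n by rewrite coprimezE.
have -> : x = u%:~R *: (m%:R *: x) + v%:~R *: (n%:R *: x).
  by rewrite !scalerA -scalerDl !pmulrn -!intrM -intrD uv scale1r.
by apply: ZspanD; exact: ZspanZ.
Qed.

End Coordinates.

(** Along this enumeration a relation that only involves smaller weights becomes a triangular
    matrix. The length [n] is free so that it can be [\dim {:L}], the size used in
    [is_discriminant]. *)
Lemma sorted_enumeration (G : finType) (w : G -> nat) n : n = #|G| ->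
  exists2 h : 'I_n -> G, bijective h &
    forall i j : 'I_n, (i < j)%N -> (w (h i) <= w (h j))%N.
Proof.
move=> nE; pose r := relpre w leq; pose l := sort r (enum G).
have sl : size l = n by rewrite size_sort -cardE nE.
(* [x0] serves as the default of [nth]; an empty [G] is treated apart. *)
have [x0|G0] := pickP G; last first.
  have n0 : n = 0%N by rewrite nE; apply: eq_card0 => x; have := G0 x.
  have nG (x : G) : False by have := G0 x.
  have ni (i : 'I_n) : False by case: i => i; rewrite n0.
  exists (fun i => False_rect G (ni i)) => [|i]; last by case: (ni i).
  by exists (fun x => False_rect 'I_n (nG x)) => [i|x]; [case: (ni i)|case: (nG x)].
move=> _; pose h (i : 'I_n) := nth x0 l i.
have ul : uniq l by rewrite sort_uniq enum_uniq.
exists h.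
  apply: inj_card_bij; last by rewrite card_ord nE.
  move=> i j /eqP; rewrite nth_uniq ?sl // => /eqP; exact: val_inj.
move=> i j ij; have := @sorted_ltn_nth _ r _ x0 l _ i j; apply => //; rewrite ?inE ?sl //.
  by move=> x y z; exact: leq_trans.
by apply: sort_sorted => x y; exact: leq_total.
Qed.

Section TriangularBasis.
Variables (L : fieldExtType rat) (G : finType) (e b : G -> L).
Variables (w ex : G -> nat) (z : G -> G -> int).
Hypothesis eb : basis_of {:L} (family_tuple e).
Hypothesis bE : forall s, (2 ^+ ex s) *: b s = e s + \sum_(t | (w t < w s)%N) (z s t)%:~R *: e t.

Lemma dim_family : \dim {:L} = #|G|.
Proof. by rewrite -(size_basis eb). Qed.

(** Induction on the weight: [bE] solved for [e s] involves [b s] and the [e t] of smaller weight,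
    with integral coefficients only. *)
Lemma Zspan_triangular s : Zspan b (e s).
Proof.
have [n] := ubnP (w s); elim: n s => // n IH s; rewrite ltnS => wn.
have -> : e s = 2 ^+ ex s *: b s - \sum_(t | (w t < w s)%N) (z s t)%:~R *: e t by rewrite bE addrK.
apply: ZspanB; first by rewrite -natrX; apply: (@ZspanZ _ _ _ (2 ^ ex s)%N); exact: Zspan_gen.
by apply: Zspan_sum => t ts; apply: ZspanZ; apply: IH; exact: leq_trans ts wn.
Qed.

Lemma basis_triangular : basis_of {:L} (family_tuple b).
Proof.
apply: family_basis; first exact: dim_family.
move=> x; rewrite (coeffK x eb).
have /choice[c cE] := Zspan_triangular.
exists (fun s => \sum_t coeff e t x * (c t s)%:~R).
under eq_bigr => t _ do rewrite cE scaler_sumr.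
rewrite exchange_big; apply: eq_bigr => s _; rewrite scaler_suml.
by apply: eq_bigr => t _; rewrite scalerA.
Qed.

Variable T : G -> rat.
Hypothesis traceE : forall s t, field_trace (e s * e t) = (s == t)%:R * T s.
Hypothesis int_b : forall s, integralZ L (b s).
Hypothesis span_b : forall x, integralZ L x -> Zspan b x.

(** In an order of increasing weight the matrix from [e] to [b] is triangular with diagonal entries
    [1 / 2 ^ ex s], and the Gram matrix of [e] is diagonal with entries [T s]. *)
Lemma discriminant_triangular (d : int) :
  d%:~R = \prod_s (T s / (2 ^+ ex s) ^+ 2) -> is_discriminant L d.
Proof.
move=> dE; have [h hb hw] := sorted_enumeration w dim_family.
have [h' hK h'K] := hb.
pose v : (\dim {:L}).-tuple L := [tuple b (h i) | i < \dim {:L}].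
have vE (i : 'I_(\dim {:L})) : v`_i = b (h i) by rewrite -tnth_nth tnth_mktuple.
have sumh (F : G -> L) : \sum_s F s = \sum_(i < \dim {:L}) F (h i).
  by rewrite (reindex h) //; exact: onW_bij.
exists v.
  split.
    rewrite basisEdim size_tuple leqnn andbT; apply/subvP => x _.
    rewrite (coeffK x basis_triangular); apply: memv_suml => s _; apply: memvZ; apply: memv_span.
    by apply/tnthP; exists (h' s); rewrite tnth_mktuple h'K.
  move=> x; split => [/span_b[c ->]|[c ->]].
    exists (fun i => c (h i)); rewrite sumh; apply: eq_bigr => i _.
    by rewrite vE scaler_int.
  apply: big_ind => [||i _]; [exact: integral0|exact: integral_add|].
  by rewrite vE -mulrzr; apply: integral_mul; [exact: int_b|exact: integral_id].
rewrite -/(trace_gram _).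
pose C : 'M[rat]_(\dim {:L}) := \matrix_(i, j) (((i == j)%:R +
  (if (w (h j) < w (h i))%N then (z (h i) (h j))%:~R else 0)) / 2 ^+ ex (h i)).
rewrite (@det_trace_gram_change _ _ _ (fun i => e (h i)) C); last first.
  move=> i; rewrite vE.
  have n0 : 2 ^+ ex (h i) != 0 :> rat by rewrite expf_neq0.
  rewrite -[LHS]scale1r -(mulVf n0) -scalerA bE scalerDr.
  rewrite big_mkcond sumh scaler_sumr.
  under [RHS]eq_bigr => j _ do rewrite mxE mulrC mulrDr scalerDl.
  rewrite big_split /=; congr (_ + _).
    rewrite (bigD1 i) //= eqxx mulr1 big1 ?addr0 // => j /negbTE ji.
    by rewrite eq_sym ji mulr0 scale0r.
  apply: eq_bigr => j _; case: ifP; rewrite ?mulr0 ?scale0r ?scaler0 // scalerA //.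
have -> : trace_gram (fun i => e (h i)) = diag_mx (\row_i T (h i)).
  apply/matrixP => i j; rewrite !mxE traceE (inj_eq (bij_inj hb)).
  by case: eqP => [->|_]; rewrite ?mul1r ?mul0r.
rewrite det_diag det_trig.
  rewrite dE (reindex h) /=; last exact: onW_bij.
  rewrite -prodrXl -big_split /=; apply: eq_bigr => i _.
  by rewrite !mxE eqxx ltnn addr0 exprMn expr1n mul1r exprVn mulrC.
apply/is_trig_mxP => i j ij; rewrite mxE.
have := hw _ _ ij; rewrite leqNgt => /negbTE ->.
by rewrite -val_eqE ltn_eqF // addr0 mul0r.
Qed.

End TriangularBasis.

(** * Monomials in the square roots *)

Lemma fieldExt_intr_eq0 (L : fieldExtType rat) (z : int) : (z%:~R == 0 :> L) = (z == 0).
Proof. by rewrite -scaler_int scaler_eq0 oner_eq0 orbF intr_eq0. Qed.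

Lemma signZ (L : fieldExtType rat) (b : bool) (x : L) : (-1) ^+ b *: x = (-1) ^+ b * x.
Proof. by case: b; rewrite ?expr1 ?expr0 ?scaleN1r ?mulN1r ?scale1r ?mul1r. Qed.

Section Multiquadratic.
Variables (k : nat) (L : fieldExtType rat) (a : 'I_k -> int) (r : 'I_k -> L).
Local Notation G := {ffun 'I_k -> bool}.
Implicit Types s t : G.

(** Exponent vectors form the group (Z/2)^k, addition in [bool] being exclusive or;
    [mono s * mono t] is then a rational multiple of [mono (s + t)]. *)
Definition mono s : L := \prod_i r i ^+ s i.
Definition radicand s : int := \prod_i a i ^+ s i.
Definition unit_index (i : 'I_k) : G := [ffun j => j == i].

Lemma mono0 : mono 0 = 1.
Proof. by rewrite /mono big1 // => i _; rewrite ffunE. Qed.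

Lemma mono_unit i : mono (unit_index i) = r i.
Proof.
rewrite /mono (bigD1 i) //= ffunE eqxx big1 ?mulr1 // => j /negbTE ji.
by rewrite ffunE ji.
Qed.

Lemma addGG s : s + s = 0.
Proof. by apply/ffunP => i; rewrite !ffunE; case: (s i). Qed.

Lemma addG_eq0 s t : (s + t == 0) = (s == t).
Proof.
have -> : s + t = s - t by rewrite -[- t]add0r -(addGG t) addrK.
exact: subr_eq0.
Qed.

Lemma card_indices : #|G| = (2 ^ k)%N.
Proof. by rewrite card_ffun card_bool card_ord. Qed.

Hypothesis r2 : forall i, r i ^+ 2 = (a i)%:~R.
Hypothesis a_neq0 : forall i, a i != 0.

Lemma monoM s t :
  mono s * mono t = (\prod_i a i ^+ (s i && t i))%:~R *: mono (s + t).
Proof.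
rewrite scaler_int -mulrzl rmorph_prod -!big_split /=; apply: eq_bigr => i _.
rewrite ffunE rmorphXn /=; case: (s i); case: (t i);
  by rewrite ?expr0 ?expr1 ?mulr1 ?mul1r // -r2 expr2.
Qed.

Lemma mono_sqr s : mono s ^+ 2 = (radicand s)%:~R.
Proof.
rewrite expr2 monoM addGG mono0 scaler_int; congr (_%:~R).
by apply: eq_bigr => i _; rewrite andbb.
Qed.

Lemma radicand_neq0 s : radicand s != 0.
Proof. by apply/prodf_neq0 => i _; rewrite expf_neq0. Qed.

Hypothesis mb : basis_of {:L} (family_tuple mono).
Local Notation cf := (coeff mono).

(** The linear map multiplying [mono s] by [(-1) ^+ s i] is multiplicative, because this sign is a
    character of the group of exponent vectors. *)
Lemma exists_flip i : exists f : {rmorphism L -> L},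
  forall j, f (r j) = (-1) ^+ (j == i) * r j.
Proof.
pose sg s : rat := (-1) ^+ s i.
pose phi (x : L) := \sum_s (cf s x * sg s) *: mono s.
have phiB : zmod_morphism phi.
  move=> x y; rewrite /phi -sumrB; apply: eq_bigr => s _.
  by rewrite coeffB mulrBl scalerBl.
have phiZ c x : phi (c *: x) = c *: phi x.
  rewrite /phi scaler_sumr; apply: eq_bigr => s _.
  by rewrite coeffZ scalerA mulrA.
have phi0 : phi 0 = 0 by have := phiZ 0 0; rewrite !scale0r.
have phiD x y : phi (x + y) = phi x + phi y.
  rewrite /phi -big_split; apply: eq_bigr => s _.
  by rewrite coeffD mulrDl scalerDl.
have phi_sum (F : G -> L) : phi (\sum_s F s) = \sum_s phi (F s) by exact: (big_morph phi phiD phi0).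
have phim s : phi (mono s) = sg s *: mono s.
  rewrite /phi (bigD1 s) //= coeff_basis // eqxx mul1r big1 ?addr0 // => t /negbTE ts.
  by rewrite coeff_basis // ts mul0r scale0r.
have phiMm s t : phi (mono s * mono t) = phi (mono s) * phi (mono t).
  rewrite monoM phiZ !phim -scalerAl -scalerAr monoM !scalerA; congr (_ *: _).
  by rewrite mulrC; congr (_ * _); rewrite /sg ffunE; case: (s i); case: (t i);
    rewrite ?expr0 ?expr1 ?mulr1 ?mulrNN ?mul1r.
have phiM : monoid_morphism phi.
  split; first by rewrite -mono0 phim /sg ffunE scale1r.
  move=> x y; rewrite (coeffK x mb) (coeffK y mb) big_distrlr /= !phi_sum big_distrlr /=.
  apply: eq_bigr => s _; rewrite phi_sum; apply: eq_bigr => t _.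
  by rewrite -scalerAl -scalerAr !phiZ phiMm -scalerAl -scalerAr.
pose f : {rmorphism L -> L} := HB.pack phi (GRing.isZmodMorphism.Build _ _ phi phiB)
  (GRing.isMonoidMorphism.Build _ _ phi phiM).
exists f => j; rewrite /f /= -mono_unit phim /sg ffunE eq_sym.
exact: signZ.
Qed.

Lemma flip_mono i (f : {rmorphism L -> L}) s :
  (forall j, f (r j) = (-1) ^+ (j == i) * r j) -> f (mono s) = (-1) ^+ s i * mono s.
Proof.
move=> fr; rewrite /mono rmorph_prod.
rewrite (bigD1 i) //= [in RHS](bigD1 i) //= rmorphXn fr eqxx exprMn mulrA.
congr (_ * _ * _).
apply: eq_bigr => j /negbTE ji; by rewrite rmorphXn fr ji mul1r.
Qed.

Lemma flip_coeff i (f : {rmorphism L -> L}) s x :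
  (forall j, f (r j) = (-1) ^+ (j == i) * r j) -> cf s (f x) = (-1) ^+ s i * cf s x.
Proof.
move=> fr; rewrite {1}(coeffK x mb) rmorph_sum /=.
transitivity (cf s (\sum_(t : G) ((-1) ^+ t i * cf t x) *: mono t)).
  2: by rewrite coeff_comb.
congr coeff; apply: eq_bigr => t _; rewrite rmorphZ_num (flip_mono t fr) -alg_num_field mulr_algl.
by rewrite -signZ !scalerA mulrC.
Qed.

(** Multiplication by [mono u] carries the line of [mono v] to that of [mono (u + v)], so it has
    zero diagonal unless [u = 0], when its trace is the degree [2 ^ k]. *)
Lemma field_trace_mono s t :
  field_trace (mono s * mono t) = (s == t)%:R * (2 ^+ k * (radicand s)%:~R).
Proof.
have tr_mono u : field_trace (mono u) = (u == 0)%:R * 2 ^+ k.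
  rewrite (field_trace_coeff _ mb).
  under eq_bigr => v _ do rewrite monoM coeffZ coeff_basis // -subr_eq0 opprD addrC addrNK oppr_eq0.
  have [->|u0] := eqVneq u 0; last by rewrite big1 ?mul0r // => v _; rewrite mulr0.
  rewrite (eq_bigr (fun=> 1)) => [|v _].
    2: by rewrite mulr1 big1 // => i _; rewrite ffunE.
  by rewrite sumr_const card_indices mul1r -natrX.
rewrite monoM field_traceZ tr_mono addG_eq0.
case: eqP => [<-|_]; last by rewrite !mul0r mulr0.
rewrite !mul1r mulrC; congr (_ * _%:~R).
by apply: eq_bigr => i _; rewrite andbb.
Qed.

Variables (g : G -> nat) (c : G -> int).
Hypothesis g_gt0 : forall s, (0 < g s)%N.
Hypothesis c_sf : forall s, squarefree `|c s|%N.
Hypothesis gc : forall s, radicand s = (g s)%:Z ^+ 2 * c s.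

Definition rmono s : L := (g s)%:R^-1 *: mono s.

Lemma g_neq0 s : (g s)%:R != 0 :> rat.
Proof. by rewrite pnatr_eq0 -lt0n. Qed.

Lemma mono_rmono s : mono s = (g s)%:R *: rmono s.
Proof. by rewrite /rmono scalerA mulfV ?scale1r // g_neq0. Qed.

Lemma rmono_basis : basis_of {:L} (family_tuple rmono).
Proof.
apply: family_basis; first by rewrite -(size_basis mb).
move=> x; exists (fun s => cf s x * (g s)%:R); rewrite {1}(coeffK x mb).
by apply: eq_bigr => s _; rewrite mono_rmono scalerA.
Qed.

Lemma rmono_sqr s : rmono s ^+ 2 = (c s)%:~R.
Proof.
rewrite /rmono exprZn mono_sqr gc -[(_ * _)%:~R]scaler_int scalerA -[RHS]scaler_int; congr (_ *: _).
by rewrite intrM rmorphXn /= -pmulrn mulrA -exprMn mulVf ?g_neq0 // expr1n mul1r.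
Qed.

Lemma field_trace_rmono s t :
  field_trace (rmono s * rmono t) = (s == t)%:R * (2 ^+ k * (c s)%:~R).
Proof.
rewrite /rmono -scalerAl -scalerAr !field_traceZ field_trace_mono.
case: eqP => [<-|_]; last by rewrite !mul0r !mulr0.
rewrite !mul1r gc intrM rmorphXn /= -pmulrn; field; exact: g_neq0.
Qed.

(** Adding to an element its conjugate under the flip of [r i], with sign [(-1) ^+ s i], doubles the
    coordinates that agree with [s] at [i] and kills the others. Doing so for every [i] leaves an
    integral element [q *: rmono s] with q = 2^k times the coordinate; its square [q^2 c_s] is a
    rational integer, and [c_s] is squarefree. *)
Lemma rmono_coeff_int x s : integralZ L x -> 2 ^+ k * coeff rmono s x \is a Num.int.
Proof.
move=> ix.
have proj (l : seq 'I_k) : uniq l -> exists2 y, integralZ L y &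
    forall t, cf t y = if all (fun i => t i == s i) l then 2 ^+ size l * cf t x else 0.
  elim: l => [|i l IH] /=; first by exists x => // t; rewrite expr0 mul1r.
  move=> /andP[_ /IH[y iy yE]]; have [f fr] := exists_flip i.
  exists (y + (-1) ^+ s i * f y).
    apply: integral_add => //; apply: integral_mul; last exact: integralZ_rmorph.
    have -> : (-1) ^+ s i = ((-1) ^+ s i)%:~R :> L by rewrite rmorphXn /= rmorphN.
    exact: integral_id.
  move=> t; rewrite coeffD.
  have -> : cf t ((-1) ^+ s i * f y) = (-1) ^+ s i * ((-1) ^+ t i * cf t y).
    by rewrite -signZ coeffZ (flip_coeff _ _ fr).
  rewrite yE exprS; case: (t i); case: (s i); rewrite /= ?expr0 ?expr1; case: ifP => _; ring.
have [y iy yE] := proj (enum 'I_k) (enum_uniq _).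
have {}yE : y = (2 ^+ k * coeff rmono s x) *: rmono s.
  have cx : cf s x = (g s)%:R^-1 * coeff rmono s x.
    rewrite [X in cf s X](coeffK x rmono_basis) /rmono.
    under eq_bigr => t _ do rewrite scalerA.
    by rewrite coeff_comb // mulrC.
  rewrite [LHS](coeffK y mb) (bigD1 s) //= big1 ?addr0 => [|t ts].
    have -> : cf s y = 2 ^+ k * cf s x.
      by rewrite yE -cardE card_ord; case: allP => // -[] i _.
    by rewrite cx /rmono scalerA; congr (_ *: _); ring.
  rewrite yE; case: allP => [st|]; last by rewrite scale0r.
  by case/eqP: ts; apply/ffunP => i; apply/eqP/st; rewrite mem_enum.
apply: (@int_of_sqr_mul_squarefree _ (c s)) => //.
apply: (@integralZ_alg L); have := integral_mul iy iy.
rewrite -expr2 yE exprZn rmono_sqr -[(c s)%:~R]scaler_int scalerA //.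
Qed.

Lemma Zspan_rmono x : integralZ L x -> Zspan rmono (2 ^+ k *: x).
Proof.
move=> ix; have /choice[z zE] : forall s, exists z : int, 2 ^+ k * coeff rmono s x = z%:~R.
  by move=> s; apply/intrP; exact: rmono_coeff_int.
exists z; rewrite {1}(coeffK x rmono_basis) scaler_sumr.
by apply: eq_bigr => s _; rewrite scalerA zE.
Qed.

End Multiquadratic.

(** * Integral bases from halved generators *)

Section IntegralBasis.
Variables (k : nat) (L : fieldExtType rat) (a : 'I_k -> int) (r : 'I_k -> L).
Local Notation G := {ffun 'I_k -> bool}.
Implicit Types s t : G.
Hypothesis r2 : forall i, r i ^+ 2 = (a i)%:~R.
Hypothesis mb : basis_of {:L} (family_tuple (mono r)).
Variable h : G -> 'I_k -> bool.

(** [h s i] tells whether [r i] enters [beta s] as [(1 + r i) / 2]. It depends on [s] because in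
    type (2,3) the half of [1 + r_2] becomes integral only after multiplication by [r_1]. *)
Definition theta s i : L := if h s i then 2^-1 *: (1 + r i) else r i.
Definition beta s : L := \prod_i theta s i ^+ s i.
Definition halvings s : nat := (\sum_i (s i && h s i))%N.
Definition weight s : nat := (\sum_i s i)%N.
(** Coefficient of [mono r t] in the product, over the [i] with [s i], of [1 + r i] where it is
    halved and of [r i] elsewhere; it vanishes unless [t] is contained in [s]. *)
Definition beta_coeff s t : int :=
  \prod_i (if s i then (if t i then 1 else (h s i)%:Z) else (~~ t i)%:Z).

Lemma weight_lt s t : (forall i, t i -> s i) -> t != s -> (weight t < weight s)%N.
Proof.
move=> ts tns; have [i si] : exists i, s i && ~~ t i.
  apply/existsP; apply: contraR tns => /existsPn st; apply/eqP/ffunP => i.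
  have := st i; have := ts i; case: (t i) => [->//|_]; by case: (s i).
rewrite /weight (bigD1 i) //= [X in (_ < X)%N](bigD1 i) //=.
case/andP: si => -> /negbTE ->; rewrite add0n add1n ltnS leq_sum // => j _.
by have := ts j; case: (t j) => // ->.
Qed.

(** Distributivity: the monomials that occur divide [mono r s], so all but [mono r s] itself have
    smaller weight. *)
Lemma beta_expand s : 2 ^+ halvings s *: beta s =
  mono r s + \sum_(t : G | (weight t < weight s)%N) (beta_coeff s t)%:~R *: mono r t.
Proof.
pose d i (x : bool) : int := if s i then (if x then 1 else (h s i)%:Z) else (~~ x)%:Z.
have -> : 2 ^+ halvings s *: beta s = \sum_(t : G) (beta_coeff s t)%:~R *: mono r t.
  rewrite /halvings -prodrXr /beta -scaler_prod.
  transitivity (\prod_i \sum_(x : bool) (d i x)%:~R *: r i ^+ x).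
    apply: eq_bigr => i _; rewrite big_bool /= /d /theta.
    case: (s i); rewrite /= ?expr1 ?expr0 ?scale1r ?scale0r ?add0r //.
    case: (h s i); rewrite ?scale1r ?scale0r ?addr0 //.
    by rewrite scalerA mulfV // scale1r addrC.
  rewrite bigA_distr_bigA; apply: eq_bigr => t _.
  by rewrite scaler_prod /beta_coeff rmorph_prod.
rewrite (bigD1 s) //=; congr (_ + _).
  rewrite /beta_coeff big1 ?scale1r // => i _; by case: (s i).
rewrite big_mkcond [RHS]big_mkcond; apply: eq_bigr => t _.
have [->|ts] := eqVneq t s; first by rewrite ltnn.
case: ltnP => // wt; rewrite /beta_coeff.
(* A vector other than [s] whose weight is not smaller is not contained in [s], so some factor of
   its coefficient is 0. *)
have [i ti] : exists i, t i && ~~ s i.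
  apply/existsP; apply: contraTT wt => /existsPn st; rewrite -ltnNge; apply: weight_lt => // i ti.
  by have := st i; rewrite ti negbK.
case/andP: ti => ti /negbTE si.
by rewrite (bigD1 i) //= si ti mul0r scale0r.
Qed.

Lemma beta_basis : basis_of {:L} (family_tuple beta).
Proof. exact: basis_triangular mb beta_expand. Qed.

Variables (g : G -> nat) (c : G -> int).
Hypothesis g_odd : forall s, odd (g s).
Hypothesis c_sf : forall s, squarefree `|c s|%N.
Hypothesis gc : forall s, radicand a s = (g s)%:Z ^+ 2 * c s.
Hypothesis int_beta : forall s, integralZ L (beta s).
Hypothesis beta_int2 : forall x, integralZ L x -> forall s, int2 (coeff beta s x).

(** The integral basis is [b s = u beta s + n e s] with [u g_s + n 2^halvings = 1]: as [mono r s] is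
    [g_s e s], this choice gives [2^halvings b s] the leading term [e s] with coefficient 1, while
    an odd [u] keeps every [beta s] in the span of [b] up to an odd factor. *)
Lemma multiquadratic_discriminant (d : int) :
  d%:~R = \prod_(s : G) (2 ^+ k * (c s)%:~R / (2 ^+ halvings s) ^+ 2) :> rat ->
  is_discriminant L d.
Proof.
have g_gt0 s : (0 < g s)%N by apply: odd_gt0.
have /choice[u /choice[n un]] : forall s, exists u, exists n,
    odd `|u|%N /\ u * (g s)%:Z + n * 2 ^+ halvings s = 1 :> int.
  move=> s; have : coprimez (g s) (2 ^ (halvings s).+1)%N.
    by rewrite coprimezE /= coprimeXr // coprimen2.
  case/coprimezP=> -[u n] /= un; exists u, (n * 2).
  have un' : u * g s + 2 * (n * (2 ^ halvings s)%N) = 1 by rewrite -[RHS]un expnS PoszM; ring.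
  split; last by rewrite -[RHS]un' -[(2 ^ _)%N%:Z]natz natrX; ring.
  have := g_odd s; move: un'; move: (n * _) (g s) => w gs; rewrite -[odd gs]/(odd `|gs%:Z|%N).
  move: gs%:Z => gz E og; apply: contraT => eu.
  have [u' uE] : exists u', u = 2 * u' by exists (u %/ 2)%Z; lia.
  by move: E; rewrite uE; lia.
have [e eE me] : exists2 e, e = rmono r g & forall s, mono r s = (g s)%:R *: e s.
  by exists (rmono r g) => // s; exact: mono_rmono.
pose b s : L := (u s)%:~R *: beta s + (n s)%:~R *: e s.
pose z s t : int := u s * beta_coeff s t * g t.
have bE s : 2 ^+ halvings s *: b s = e s + \sum_(t : G | (weight t < weight s)%N) (z s t)%:~R *: e t.
  rewrite /b scalerDr scalerA mulrC -scalerA beta_expand scalerDr addrAC; congr (_ + _).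
    rewrite me !scalerA -scalerDl -[RHS]scale1r; congr (_ *: _).
    have [_ /(congr1 (fun z : int => z%:~R : rat))] := un s.
    by rewrite intrD !intrM rmorphXn /= -pmulrn => E; rewrite -[RHS]E; ring.
  rewrite scaler_sumr; apply: eq_bigr => t _.
  by rewrite me !scalerA /z !intrM -pmulrn ?mulrA.
have eb : basis_of {:L} (family_tuple e) by rewrite eE; exact: rmono_basis.
have int_e s : integralZ L (e s).
  by apply: integralZ_sqrt; rewrite eE (rmono_sqr r2 g_gt0 gc); exact: integral_id.
have int_scale (y : int) (x : L) : integralZ L x -> integralZ L (y%:~R *: x).
  by move=> ix; rewrite scaler_int -mulrzl; apply: integral_mul => //; exact: integral_id.
apply: (discriminant_triangular eb bE) => [s t|s|x ix].
- by rewrite eE; exact: field_trace_rmono.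
- by rewrite /b; apply: integral_add; exact: int_scale.
have betab s : Zspan b ((u s)%:~R *: beta s).
  have -> : (u s)%:~R *: beta s = b s - (n s)%:~R *: e s by rewrite /b addrK.
  apply: ZspanB; first exact: Zspan_gen.
  by apply: ZspanZ; exact: (Zspan_triangular bE).
(* The coordinates of [x] on [beta] have odd denominators, and each [beta s] times the odd [u s]
   lies in the span of [b]. *)
have [N oN Nx] : up_to_odd (Zspan b) x.
  rewrite (coeffK x beta_basis); apply: big_ind => [||s _].
  - by exists 1%N => //; rewrite mulr1n; exists (fun=> 0); rewrite big1 // => s _; rewrite scale0r.
  - by move=> x1 x2; apply: up_to_oddD => ? ?; exact: ZspanB.
  have [m om /intrP[y yE]] := beta_int2 ix s.
  exists (m * `|u s|)%N; first by rewrite oddM om; case: (un s).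
  rewrite mulrnA scalerMnl yE -scaler_nat scalerA mulrC -scalerA; apply: ZspanZ.
  have [E|E] : `|u s|%N%:Z = u s \/ `|u s|%N%:Z = - 1 * u s by lia.
    by rewrite pmulrn E; exact: betab.
  by rewrite pmulrn E intrM -scalerA; apply: ZspanZ; exact: betab.
(* The multiple by [2 ^ k] lies in the span of [e], hence in that of [b]; the odd multiple by [N]
   was just obtained. *)
apply: (@Zspan_coprime _ _ _ (2 ^ k)%N N).
- by rewrite coprimeXl // coprime2n.
- rewrite natrX; apply: (@Zspan_trans _ _ _ e); last by rewrite eE; exact: (Zspan_rmono r2 mb g_gt0 c_sf gc ix).
  exact: (Zspan_triangular bE).
- by rewrite scaler_nat.
Qed.

End IntegralBasis.

(** * Elements integral at 2 *)

Lemma rmorph_scale (L : fieldExtType rat) (f : {rmorphism L -> L}) (q : rat) x :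
  f (q *: x) = q *: f x.
Proof. by rewrite rmorphZ_num -alg_num_field mulr_algl. Qed.

(** Turns scalars into elements of [L], so that [ring] applies to mixed expressions; [j] is kept
    abstract. *)
Lemma scale_rmorph (L : fieldExtType rat) :
  exists j : {rmorphism rat -> L}, forall (q : rat) (x : L), q *: x = j q * x.
Proof. by exists (in_alg L) => q x; rewrite mulr_algl. Qed.

Lemma integralZ_quadratic (L : fieldExtType rat) (m n : int) x :
  x ^+ 2 = x *~ m + n%:~R -> integralZ L x.
Proof.
move=> xE; pose q : {poly L} := (m%:~R)%:P * 'X + (n%:~R)%:P.
have sq : (size (- q) < size ('X^2 : {poly L}))%N.
  rewrite size_polyN size_polyXn size_MXaddC; case: ifP => // _.
  by rewrite ltnS; exact: size_polyC_leq1.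
apply: (@integral_root_monic _ _ _ _ ('X^2 - q)).
- by rewrite monicE lead_coefDl // lead_coefXn.
- by rewrite rootE !hornerE xE mulrzl subrr.
- apply/integral_poly => i; rewrite !coefE; apply: integral_sub; first exact: integral_nat.
  apply: integral_add.
    by apply: integral_mul; [exact: integral_id|exact: integral_nat].
  by case: ifP => _; [exact: integral_id|exact: integral0].
Qed.

Section LocalIntegers.
Variable L : fieldExtType rat.

Definition integral2 : L -> Prop := up_to_odd (integralZ L).

Lemma integral2W x : integralZ L x -> integral2 x.
Proof. by exists 1%N. Qed.

Lemma integral2B x y : integral2 x -> integral2 y -> integral2 (x - y).
Proof. by apply: up_to_oddB => ? ?; exact: integral_sub. Qed.

Lemma integral2D x y : integral2 x -> integral2 y -> integral2 (x + y).
Proof. by apply: up_to_oddD => ? ?; exact: integral_sub. Qed.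

Lemma integral2M x y : integral2 x -> integral2 y -> integral2 (x * y).
Proof. by apply: up_to_oddM => ? ?; exact: integral_mul. Qed.

Lemma integral2_rmorph (f : {rmorphism L -> L}) x : integral2 x -> integral2 (f x).
Proof. by move=> [n on ix]; exists n => //; rewrite -rmorphMn; exact: integralZ_rmorph. Qed.

Lemma integral2_alg (q : rat) : integral2 q%:A -> int2 q.
Proof. by move=> [n on]; rewrite scalerMnl => /integralZ_alg; exists n. Qed.

Lemma integral2_oddz (z : int) x : odd `|z|%N -> integral2 (z%:~R * x) -> integral2 x.
Proof.
move=> oz ix; apply: (up_to_oddMn oz).
have [e eE] : exists e : int, `|z|%N%:Z = e * z.
  have : `|z|%N%:Z = z \/ `|z|%N%:Z = - z by lia.
  by case=> ->; [exists 1|exists (-1)]; rewrite ?mul1r ?mulN1r.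
have -> : x *+ `|z|%N = e%:~R * (z%:~R * x).
  by rewrite mulrA -intrM -eE -pmulrn mulr_natl.
by apply: integral2M => //; apply: integral2W; exact: integral_id.
Qed.

(** The trace of the element, the square of its difference with the conjugate, and its norm are the
    three inputs of [int2_quadratic]. *)
Lemma integral2_quadratic (f : {rmorphism L -> L}) (rho : L) (m : int) (p q : rat) :
  rho ^+ 2 = m%:~R -> f rho = - rho -> (m %% 4)%Z = 2 \/ (m %% 4)%Z = 3 ->
  integral2 (p%:A + q *: rho) -> int2 p /\ int2 q.
Proof.
move=> rho2 frho m4 ix; have ifx := integral2_rmorph f ix.
have fxE : f (p%:A + q *: rho) = p%:A - q *: rho.
  by rewrite rmorphD /= !rmorph_scale rmorph1 frho scalerN.
rewrite fxE in ifx.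
have algE (z : int) : z%:~R = (z%:~R : rat)%:A :> L by rewrite scaler_int.
apply: (int2_quadratic m4); apply: integral2_alg.
- have := integral2D ix ifx; congr integral2.
  by rewrite addrACA subrr addr0 -scalerDl; congr (_ *: _); ring.
- have := integral2B ix ifx; rewrite opprB addrC addrA addrNK -scalerDl => i2.
  have := integral2M i2 i2; congr integral2.
  rewrite -expr2 exprZn rho2 algE scalerA; congr (_ *: _); ring.
- have := integral2M ix ifx; congr integral2.
  rewrite mulrC -subr_sqr !exprZn rho2 expr1n algE scalerA -scalerBl; congr (_ *: _); ring.
Qed.

(** The traces to the subfields generated by [r1], [r0] and [r0 * r1] lie in quadratic fields with
    radicand 3, 2 and 2 modulo 4, so all doubled coordinates are integral at 2. *)
Lemma integral2_biquadratic (f0 f1 : {rmorphism L -> L}) (r0 r1 : L) (a0 a1 : int)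
    (y0 y1 z0 z1 : rat) :
  r0 ^+ 2 = a0%:~R -> r1 ^+ 2 = a1%:~R ->
  f0 r0 = - r0 -> f0 r1 = r1 -> f1 r0 = r0 -> f1 r1 = - r1 ->
  (a0 %% 4)%Z = 2 -> (a1 %% 4)%Z = 3 ->
  integral2 (y0%:A + y1 *: r1 + z0 *: r0 + z1 *: (r0 * r1)) ->
  [/\ int2 y0, int2 y1, int2 (z0 - z1) & int2 (2 * z1)].
Proof.
move=> s0 s1 f00 f01 f10 f11 h0 h1 ix.
have [j sc] := scale_rmorph L.
have a01 : (a0 * a1 %% 4)%Z = 2 \/ (a0 * a1 %% 4)%Z = 3.
  have [t0 ->] : exists t, a0 = 4 * t + 2 by exists (a0 %/ 4)%Z; lia.
  have [t1 ->] : exists t, a1 = 4 * t + 3 by exists (a1 %/ 4)%Z; lia.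
  by left; lia.
have sr : (r0 * r1) ^+ 2 = (a0 * a1)%:~R by rewrite exprMn s0 s1 -intrM.
have f0r : f0 (r0 * r1) = - (r0 * r1) by rewrite rmorphM /= f00 f01 mulNr.
have i0 := integral2_rmorph f0 ix; have i1 := integral2_rmorph f1 ix.
have i01 := integral2_rmorph f1 i0.
have [Y0 Y1] : int2 (2 * y0) /\ int2 (2 * y1).
  apply: (integral2_quadratic s1 f11 (or_intror h1)); have := integral2D ix i0; congr integral2.
  rewrite !rmorphD /= !rmorph_scale rmorphM /= rmorph1 f00 f01.
  rewrite !sc !rmorphM rmorph_nat.
  by move: (j y0) (j y1) (j z0) (j z1) => *; ring.
have [_ Z0] : int2 (2 * y0) /\ int2 (2 * z0).
  apply: (integral2_quadratic s0 f00 (or_introl h0)); have := integral2D ix i1; congr integral2.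
  rewrite !rmorphD /= !rmorph_scale rmorphM /= rmorph1 f10 f11.
  rewrite !sc !rmorphM rmorph_nat.
  by move: (j y0) (j y1) (j z0) (j z1) => *; ring.
have [_ Z1] : int2 (2 * y0) /\ int2 (2 * z1).
  apply: (integral2_quadratic sr f0r a01); have := integral2D ix i01; congr integral2.
  rewrite !rmorphD /= !rmorph_scale !rmorphM /= !rmorph1 f00 f01 rmorphN f10 f11.
  rewrite !sc !rmorphM rmorph_nat.
  by move: (j y0) (j y1) (j z0) (j z1) => *; ring.
(* These are the coordinates on 1 and [r1] of the norm [x * f0 x] to the field of [r1]. *)
have [N0 N1] : int2 (y0 ^+ 2 + a1%:~R * y1 ^+ 2 - a0%:~R * (z0 ^+ 2 + a1%:~R * z1 ^+ 2)) /\
    int2 (2 * (y0 * y1 - a0%:~R * (z0 * z1))).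
  apply: (integral2_quadratic s1 f11 (or_intror h1)); have := integral2M ix i0; congr integral2.
  rewrite !rmorphD /= !rmorph_scale rmorphM /= rmorph1 f00 f01.
  rewrite !sc !(rmorph1, rmorph_int, rmorphM, rmorphB, rmorphD, rmorphXn) -s0 -s1.
  by move: (j y0) (j y1) (j z0) (j z1) => *; ring.
by have [] := int2_biquadratic h0 h1 Y0 Y1 Z0 Z1 N0 N1.
Qed.

End LocalIntegers.

(** * Stripping the unramified generators *)

(** With [m = 4 n + 1] the element is a root of [X^2 - X - n]. *)
Lemma integralZ_half (L : fieldExtType rat) (rho : L) (m : int) :
  rho ^+ 2 = m%:~R -> (m %% 4)%Z = 1 -> integralZ L (2^-1 *: (1 + rho)).
Proof.
move=> rho2 m4; have [n mE] : exists n, m = 4 * n + 1 by exists (m %/ 4)%Z; lia.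
apply: (@integralZ_quadratic _ 1 n); rewrite mulr1z exprZn.
have -> : (1 + rho) ^+ 2 = 2 *: (1 + rho) + 4 *: n%:~R.
  have [j sc] := scale_rmorph L.
  by rewrite sqrrD rho2 mE !sc !rmorph_nat intrD intrM; ring.
by rewrite scalerDr !scalerA; congr (_ *: _ + _); rewrite -[RHS]scale1r.
Qed.

Section Peeling.
Variables (k : nat) (L : fieldExtType rat) (a : 'I_k -> int) (r : 'I_k -> L).
Local Notation G := {ffun 'I_k -> bool}.
Implicit Types s t : G.
Hypothesis r2 : forall i, r i ^+ 2 = (a i)%:~R.
Hypothesis mb : basis_of {:L} (family_tuple (mono r)).
Variables (h : G -> 'I_k -> bool) (U : pred 'I_k).
Hypothesis hU : forall s i, U i -> h s i.
Hypothesis h_local : forall s t, (forall i, ~~ U i -> s i = t i) -> h s =1 h t.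
Hypothesis aU : forall i, U i -> (a i %% 4)%Z = 1.

Definition clear_index (l : seq 'I_k) s : G := [ffun i => s i && (i \notin l)].

Lemma integralZ_root i : integralZ L (r i).
Proof. by apply: integralZ_sqrt; rewrite r2; exact: integral_id. Qed.

(** By [h_local] the choice of the halved factors ignores the coordinates in [U], so clearing [i]
    removes a single factor and leaves the others unchanged. *)
Lemma beta_clear_cons i l s : U i -> i \notin l -> all U l ->
  beta r h (clear_index l s) =
  (if s i then 2^-1 *: (1 + r i) else 1) * beta r h (clear_index (i :: l) s).
Proof.
move=> Ui il /allP Ul; rewrite /beta (bigD1 i) //= [in RHS](bigD1 i) //= mulrA.
have hE : h (clear_index l s) =1 h (clear_index (i :: l) s).
  apply: h_local => j Uj; rewrite !ffunE inE; case: eqVneq => [ji|//].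
  by rewrite ji Ui in Uj.
congr (_ * _).
  rewrite !ffunE inE eqxx il andbT andbF expr0 mulr1 /theta hU //.
  by case: (s i).
by apply: eq_bigr => j ji; rewrite /theta hE !ffunE inE (negbTE ji).
Qed.

Lemma flip_beta i (f : {rmorphism L -> L}) s :
  (forall j, f (r j) = (-1) ^+ (j == i) * r j) -> ~~ s i -> f (beta r h s) = beta r h s.
Proof.
move=> fr /negbTE si; rewrite /beta rmorph_prod; apply: eq_bigr => j _.
have [->|ji] := eqVneq j i; first by rewrite si !expr0 rmorph1.
have fj : f (r j) = r j by rewrite fr (negbTE ji) mul1r.
by rewrite rmorphXn /theta; case: (h s j); rewrite ?rmorph_scale ?rmorphD ?rmorph1 fj.
Qed.

(* Coefficients of 1 and (1 + r_i) / 2 are read off from x and its conjugate;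
   the unramified generators are removed one by one. *)
Lemma integral2_peel (c : G -> rat) (l : seq 'I_k) (A : G) : uniq l -> all U l ->
  integral2 (\sum_s c s *: beta r h s) ->
  integral2 (\sum_(s : G | all (fun i => s i == A i) l) c s *: beta r h (clear_index l s)).
Proof.
move=> + + ix; elim: l => [_ _|i l IH] /=.
  move: ix; congr integral2; apply: eq_bigr => s _; congr (_ *: beta _ _ _).
  by apply/ffunP => i; rewrite ffunE andbT.
move=> /andP[il ul] /andP[Ui Ul]; have {}IH := IH ul Ul.
pose P s := all (fun i => s i == A i) l.
pose Y := \sum_(s : G | P s && ~~ s i) c s *: beta r h (clear_index (i :: l) s).
pose Z := \sum_(s : G | P s && s i) c s *: beta r h (clear_index (i :: l) s).
pose X := Y + 2^-1 *: (1 + r i) * Z.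
have {}IH : integral2 X.
  move: IH; congr integral2; rewrite (bigID (fun s : G => s i)) /= addrC; congr (_ + _).
    apply: eq_bigr => s /andP[_ /negbTE si].
    by rewrite (beta_clear_cons _ Ui il Ul) si mul1r.
  rewrite mulr_sumr; apply: eq_bigr => s /andP[_ si].
  by rewrite (beta_clear_cons _ Ui il Ul) si scalerAr.
have [f fr] := exists_flip r2 mb i.
have fi : f (r i) = - r i by rewrite fr eqxx mulN1r.
have fsum (Q : pred G) : f (\sum_(s | Q s) c s *: beta r h (clear_index (i :: l) s)) =
    \sum_(s | Q s) c s *: beta r h (clear_index (i :: l) s).
  rewrite rmorph_sum; apply: eq_bigr => s _; rewrite rmorph_scale (flip_beta fr) //.
  by rewrite ffunE inE eqxx andbF.
have iZ : integral2 Z.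
  have ai := aU Ui; apply: (@integral2_oddz _ (a i)); first by lia.
  (* [Y] and [Z] do not involve [r i], hence [X - f X = r i * Z]; a second factor [r i] turns this
     into a multiple of [Z] by the odd integer [a i]. *)
  have -> : (a i)%:~R * Z = r i * (X - f X).
    rewrite /X rmorphD rmorphM rmorph_scale /= rmorphD rmorph1 !fsum fi -r2.
    have [j sc] := scale_rmorph L.
    have h2 : j 2^-1 + j 2^-1 = 1 by rewrite -rmorphD -[RHS](rmorph1 j); congr (j _).
    rewrite !sc -/Y -/Z.
    transitivity (r i ^+ 2 * Z * (j 2^-1 + j 2^-1)); first by rewrite h2 mulr1.
    by generalize (j 2^-1) Y Z (r i) => *; ring.
  apply: integral2M; first exact/integral2W/integralZ_root.
  by apply: integral2B => //; exact: integral2_rmorph.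
have iY : integral2 Y.
  have -> : Y = X - 2^-1 *: (1 + r i) * Z by rewrite /X addrK.
  apply: integral2B => //; apply: integral2M => //; apply: integral2W.
  exact: integralZ_half (r2 i) (aU Ui).
(* [A i] selects which of the two integral parts is kept. *)
have [Ai|Ai] := boolP (A i).
  by move: iZ; congr integral2; apply: eq_bigl => s; rewrite eqb_id andbC.
move: iY; congr integral2; apply: eq_bigl => s.
by rewrite eqbF_neg andbC.
Qed.

Lemma integralZ_beta s : (forall i, s i -> h s i -> (a i %% 4)%Z = 1) -> integralZ L (beta r h s).
Proof.
move=> hs; apply: big_ind => [||i _]; [exact: integral1|exact: integral_mul|].
have := hs i; case: (s i) => /= [/(_ isT) hi|_]; last by rewrite expr0; exact: integral1.
rewrite expr1 /theta; case: ifP => [/hi ai|_]; last exact: integralZ_root.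
exact: integralZ_half (r2 i) ai.
Qed.

(** With [A = s] this isolates the coefficient of [beta s] in a sum over the vectors that agree with
    [s] on [U]: one, two or four terms in the applications. *)
Lemma integral2_peel_all x (A : G) : integralZ L x -> integral2
  (\sum_(s : G | [forall i, U i ==> (s i == A i)]) coeff (beta r h) s x *:
      beta r h [ffun i => s i && ~~ U i]).
Proof.
move=> /integral2W; rewrite {1}(coeffK x (beta_basis mb h)).
move/(@integral2_peel _ (enum U) A (enum_uniq _)).
have -> : all U (enum U) by apply/allP => i; rewrite mem_enum.
move/(_ isT); congr integral2; apply: eq_big => [s|s _].
  apply/allP/forallP => H i; first by apply/implyP => Ui; apply: H; rewrite mem_enum.
  by rewrite mem_enum => Ui; have /implyP := H i; apply.
by congr (_ *: beta _ _ _); apply/ffunP => i; rewrite !ffunE mem_enum.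
Qed.

End Peeling.

(** * The product of the squarefree parts *)

Lemma logn_squarefree p n : squarefree n -> (logn p n <= 1)%N.
Proof.
move=> sf; have n0 := squarefree_gt0 sf.
have [pp|npp] := boolP (prime p); last by rewrite lognE (negbTE npp).
rewrite leqNgt; apply/negP; rewrite -pfactor_dvdn // => /sf p1.
by rewrite p1 in pp.
Qed.

Lemma logn_bigprod p (I : finType) (F : I -> nat) : (forall i, 0 < F i)%N ->
  logn p (\prod_i F i) = (\sum_i logn p (F i))%N.
Proof.
move=> F0; suff [] : (0 < \prod_i F i)%N /\ logn p (\prod_i F i) = (\sum_i logn p (F i))%N by [].
apply: (big_rec2 (fun x y => (0 < x)%N /\ logn p x = y)) => [|i x y _ [x0 <-]].
  by rewrite logn1.
by rewrite muln_gt0 F0 lognM.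
Qed.

Lemma logn_rad q n : logn q (rad n) = (q \in primes n).
Proof.
rewrite /rad -count_uniq_mem ?primes_uniq //.
have : all prime (primes n) by apply/allP => p; rewrite mem_primes => /andP[].
elim: (primes n) => [|p l IH] /=; first by rewrite big_nil logn1.
move=> /andP[pp /[dup] al /IH <-]; rewrite big_cons lognM ?(prime_gt0 pp) //.
  by rewrite logn_prime // eq_sym.
rewrite big_seq prodn_cond_gt0 // => r rl.
exact/prime_gt0/(allP al).
Qed.

Lemma rad_gt0 n : (0 < rad n)%N.
Proof. by rewrite /rad big_seq prodn_cond_gt0 // => p; rewrite mem_primes => /andP[/prime_gt0]. Qed.

Lemma squarefree_rad n : squarefree (rad n).
Proof.
move=> d dr; apply/eqP; rewrite eqn_leq (dvdn_gt0 _ (dvdn_trans (dvdn_exp _ (dvdnn d)) dr)) ?rad_gt0 // andbT.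
rewrite leqNgt; apply/negP => d1.
have pp := pdiv_prime d1; have pd := pdiv_dvd d.
have : (pdiv d ^ 2 %| rad n)%N by apply: dvdn_trans dr; rewrite dvdn_exp2r.
by rewrite pfactor_dvdn ?rad_gt0 // logn_rad; case: (_ \in _).
Qed.

Section SquarefreeParts.
Variable k : nat.
Local Notation G := {ffun 'I_k -> bool}.
Implicit Types s t : G.

Lemma add_unitE s i j : (s + unit_index i) j = s j (+) (j == i).
Proof. by rewrite !ffunE. Qed.

Lemma sum_add_unit (F : G -> nat) i : (\sum_s F s = \sum_(s : G) F (s + unit_index i)%R)%N.
Proof.
rewrite (reindex_inj (h := fun s : G => s + unit_index i)) //.
exact: addIr.
Qed.

(** Translation by [unit_index i] pairs the indices in [P] with those outside [P] and preserves
    [Q]. *)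
Lemma sum_half (P Q : pred G) i :
  (forall s, Q (s + unit_index i) = Q s) -> (forall s, P (s + unit_index i) = ~~ P s) ->
  (2 * \sum_s (P s && Q s) = \sum_s Q s)%N.
Proof.
move=> Qi Pi; rewrite mul2n -addnn {2}(sum_add_unit _ i) -big_split /=.
by apply: eq_bigr => s _; rewrite Qi Pi; case: (P s); case: (Q s).
Qed.

Lemma sum_index i : (2 * \sum_(s : G) s i = 2 ^ k)%N.
Proof.
have := @sum_half (fun s => s i) predT i (fun=> erefl) _; rewrite sum_nat_const muln1 card_indices.
under eq_bigr => s _ do rewrite andbT.
by apply => s; rewrite add_unitE eqxx addbT.
Qed.

Lemma sum_index2 i j : i != j -> (4 * \sum_(s : G) (s i && s j) = 2 ^ k)%N.
Proof.
move=> ij; rewrite -[4%N]/(2 * 2)%N -mulnA (@sum_half (fun s => s i) (fun s => s j) i).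
- exact: sum_index.
- by move=> s; rewrite add_unitE eq_sym (negbTE ij) addbF.
- by move=> s; rewrite add_unitE eqxx addbT.
Qed.

Variables (a : 'I_k -> int) (g : G -> nat) (c : G -> int).
Hypothesis a_neq0 : forall i, a i != 0.
Hypothesis g_gt0 : forall s, (0 < g s)%N.
Hypothesis c_sf : forall s, squarefree `|c s|%N.
Hypothesis gc : forall s, radicand a s = (g s)%:Z ^+ 2 * c s.

Lemma radicand_add_unit s i : ~~ s i -> radicand a (s + unit_index i) = a i * radicand a s.
Proof.
move=> /negbTE si; rewrite /radicand (bigD1 i) //= [in RHS](bigD1 i) //= mulrA.
rewrite add_unitE si eqxx expr0 mulr1; congr (_ * _).
by apply: eq_bigr => j /negbTE ji; rewrite add_unitE ji addbF.
Qed.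

Lemma radicand_gt0 s : (0 < `|radicand a s|)%N.
Proof. by rewrite absz_gt0 (radicand_neq0 a_neq0). Qed.

Lemma logn_squarefree_part p s : logn p `|c s|%N = odd (logn p `|radicand a s|%N).
Proof.
have c0 : (0 < `|c s|)%N := squarefree_gt0 (@c_sf s).
rewrite gc abszM abszX lognM ?expn_gt0 ?g_gt0 // lognX oddD oddM /=.
by have := logn_squarefree p (@c_sf s); case: logn => [|[|]].
Qed.

Hypothesis a_sf : forall i, squarefree `|a i|%N.
Hypothesis k_ge2 : (2 <= k)%N.

(** A prime [p] divides [c s] iff its valuation in the radicand is odd. If [p] divides some [a i],
    it does so exactly once, so translation by [unit_index i] flips this parity and [p] divides
    exactly half of the [c s]; any other prime divides none. *)
Lemma prod_squarefree_parts :
  \prod_s c s = ((rad `|(\prod_i a i)%R|) ^ (2 ^ (k - 1)))%N%:Z.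
Proof.
have k2 : (2 ^ k = 2 * 2 ^ (k - 1))%N by rewrite -expnS subn1 prednK // (ltnW k_ge2).
have pa0 : \prod_i a i != 0 by apply/prodf_neq0.
(* The radicands multiply to the product of the [a i ^ 2^(k-1)], a square because [2 <= k]. *)
have pos : 0 <= \prod_s c s.
  have : 0 <= (\prod_s (g s)%:Z) ^+ 2 * \prod_s c s.
    rewrite -prodrXl -big_split /=; under eq_bigr => s _ do rewrite -gc.
    rewrite /radicand exchange_big /=; apply: prodr_ge0 => i _.
    rewrite prodrXr; have -> : (\sum_(s : G) s i = 2 * 2 ^ (k - 2))%N.
      have := sum_index i; have -> : (2 ^ k = 2 * (2 * 2 ^ (k - 2)))%N.
        by rewrite -!expnS; congr expn; lia.
      by lia.
    by rewrite exprM exprn_ge0 // sqr_ge0.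
  rewrite pmulr_rge0 // exprn_gt0 // prodr_gt0 // => s _.
  by rewrite ltz_nat.
rewrite -[LHS]gez0_abs //; congr Posz.
have absp : `|(\prod_s c s)%R|%N = (\prod_s `|c s|)%N.
  exact: (big_morph _ abszM).
have cs0 s : (0 < `|c s|)%N := squarefree_gt0 (@c_sf s).
apply: eqn_from_log; rewrite ?expn_gt0 ?rad_gt0 ?absp ?prodn_gt0 // => p.
rewrite lognX logn_rad logn_bigprod //.
under eq_bigr => s _ do rewrite logn_squarefree_part.
have [pp|npp] := boolP (prime p); last first.
  rewrite mem_primes (negbTE npp) muln0 big1 // => s _.
  by rewrite lognE (negbTE npp).
have absa : `|(\prod_i a i)%R|%N = (\prod_i `|a i|)%N by exact: (big_morph _ abszM).
have [/existsP[i pi]|npa] := boolP [exists i, (p %| `|a i|)%N].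
  have -> : (p \in primes `|(\prod_i a i)%R|%N).
    by rewrite mem_primes pp absz_gt0 pa0 absa (bigD1 i) //= dvdn_mulr.
  have li : logn p `|a i|%N = 1%N.
    apply/eqP; rewrite eqn_leq logn_squarefree //= logn_gt0 mem_primes pp pi absz_gt0 a_neq0 //.
  have key s : ~~ s i -> odd (logn p `|radicand a (s + unit_index i)|) = ~~ odd (logn p `|radicand a s|).
    by move=> si; rewrite radicand_add_unit // abszM lognM ?radicand_gt0 ?absz_gt0 // li.
  have := @sum_half (fun s => odd (logn p `|radicand a s|)) predT i (fun=> erefl) _.
  rewrite sum_nat_const muln1 card_indices k2.
  under eq_bigr => s _ do rewrite andbT.
  move=> H; have {}H := H _; rewrite muln1; suff /H : forall s : G,
    odd (logn p `|radicand a (s + unit_index i)|) = ~~ odd (logn p `|radicand a s|).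
    by move/eqP; rewrite eqn_pmul2l // => /eqP.
  move=> s; have [si|si] := boolP (s i); last exact: key.
  have si' : ~~ (s + unit_index i) i by rewrite add_unitE eqxx si.
  by have := key _ si'; rewrite -addrA addGG addr0 => ->; rewrite negbK.
have pa i : ~~ (p %| `|a i|)%N by move/existsPn: npa; apply.
have -> : (p \in primes `|(\prod_i a i)%R|%N) = false.
  apply/negP; rewrite mem_primes => /and3P[_ _]; rewrite absa.
  by rewrite Euclid_dvd_prod // big_orE => /existsP[i]; rewrite (negbTE (pa i)).
rewrite muln0 big1 // => s _; rewrite /radicand.
have -> : logn p `|(\prod_i a i ^+ s i)%R|%N = 0%N; last by [].
rewrite (big_morph _ abszM (erefl : absz 1 = 1%N)) logn_bigprod => [|i].
  by rewrite big1 // => i _; rewrite abszX lognX lognE pp absz_gt0 a_neq0 (negbTE (pa i)) muln0.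
by rewrite abszX expn_gt0 absz_gt0 a_neq0.
Qed.

End SquarefreeParts.

(** * Discriminants of the four types *)

(** With [m0 = 2 t0] and [m1 = 2 t1 - 1] the square of the element is [t0 (t1 + rho1)], which is
    integral. *)
Lemma integralZ_mul_half (L : fieldExtType rat) (rho0 rho1 : L) (m0 m1 : int) :
  rho0 ^+ 2 = m0%:~R -> rho1 ^+ 2 = m1%:~R -> (m0 %% 4)%Z = 2 -> (m1 %% 4)%Z = 3 ->
  integralZ L (rho0 * (2^-1 *: (1 + rho1))).
Proof.
move=> s0 s1 h0 h1; apply: integralZ_sqrt.
have [t0 E0] : exists t, m0 = 2 * t by exists (m0 %/ 2)%Z; lia.
have [t1 E1] : exists t, m1 = 2 * t - 1 by exists ((m1 + 1) %/ 2)%Z; lia.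
have [j sc] := scale_rmorph L.
have h2 : j 2^-1 * 2 = 1 by rewrite -(rmorph_nat j 2) -rmorphM mulVf ?rmorph1.
have -> : (rho0 * (2^-1 *: (1 + rho1))) ^+ 2 = t0%:~R * (t1%:~R + rho1).
  rewrite sc; generalize (j 2^-1) h2 => u {}h2.
  transitivity (rho0 ^+ 2 * u ^+ 2 * (1 + 2 * rho1 + rho1 ^+ 2)); first by ring.
  rewrite s0 s1 E0 E1 intrB !intrM.
  transitivity (t0%:~R * (t1%:~R + rho1) * (u * 2) ^+ 2); first by ring.
  by rewrite h2 expr1n mulr1.
apply: integral_mul; first exact: integral_id.
by apply: integral_add; [exact: integral_id|apply: integralZ_sqrt; rewrite s1; exact: integral_id].
Qed.

Section DiscriminantTypes.
Variables (k : nat) (L : fieldExtType rat) (a : 'I_k -> int) (r : 'I_k -> L).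
Local Notation G := {ffun 'I_k -> bool}.
Implicit Types s t A : G.
Hypothesis k_ge2 : (2 <= k)%N.
Hypothesis r2 : forall i, r i ^+ 2 = (a i)%:~R.
Hypothesis a_sf : forall i, squarefree `|a i|%N.
Hypothesis mb : basis_of {:L} (family_tuple (mono r)).

Lemma squarefree_neq0 i : a i != 0.
Proof. by rewrite -absz_gt0; exact: squarefree_gt0 (@a_sf i). Qed.
Local Notation a_neq0 := squarefree_neq0.

(** Only [a i0] can be even, and it is squarefree. Consequently the square factors taken out of the
    radicands are odd, and passing from [mono] to [rmono] changes nothing at 2. *)
Lemma radicand_not_dvd4 (i0 : 'I_k) : (forall i, i != i0 -> odd `|a i|%N) ->
  forall s, ~~ (4 %| radicand a s)%Z.
Proof.
move=> ao s; rewrite /radicand (bigD1 i0) //=; apply/negP.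
move=> /dvd4_of_odd_mul H; have {H} : (4 %| a i0 ^+ s i0)%Z.
  apply: H; rewrite (big_morph _ abszM (erefl : absz 1 = 1%N)).
  by apply: (big_ind (fun n => odd n)) => [//|x y ox oy|i /ao oi]; rewrite ?oddM ?ox // abszX oddX oi orbT.
case: (s i0); rewrite ?expr0 // expr1 => a4; have /(_ 2%N) := @a_sf i0; apply/not_implyP.
by split=> //; move: a4; rewrite /dvdz /=.
Qed.

(** Apart from the [c s], the determinant is the power of 2 with exponent [k 2^k] minus twice the
    number of halvings; [j] records this exponent in units of [2^(k-1)]. *)
Lemma discriminant_of_halvings (h : G -> 'I_k -> bool) (j : nat) (i0 : 'I_k) :
  (forall i, i != i0 -> odd `|a i|%N) ->
  (forall s, integralZ L (beta r h s)) ->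
  (forall x, integralZ L x -> forall s, int2 (coeff (beta r h) s x)) ->
  (2 * \sum_s halvings h s + j * 2 ^ (k - 1) = k * 2 ^ k)%N ->
  is_discriminant L (((2 ^ j * rad `|(\prod_i a i)%R|) ^ (2 ^ (k - 1)))%N%:Z).
Proof.
move=> ao ib bi hj.
have /choice[g /choice[c gcP]] := fun s => squarefree_decomp (radicand_neq0 a_neq0 s).
have g_gt0 s : (0 < g s)%N by case: (gcP s).
have c_sf s : squarefree `|c s|%N by case: (gcP s).
have gc s : radicand a s = (g s)%:Z ^+ 2 * c s by case: (gcP s).
have g_odd s : odd (g s).
  apply: contraT => eg; move/negP: (radicand_not_dvd4 ao s); case.
  have [g' gE] : exists g' : nat, g s = (2 * g')%N by exists (g s %/ 2)%N; lia.
  by rewrite gc gE; apply/dvdzP; exists (g'%:Z ^+ 2 * c s); rewrite PoszM; ring.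
apply: (multiquadratic_discriminant r2 mb g_odd c_sf gc ib bi).
rewrite prodf_div big_split /= prodr_const card_indices -rmorph_prod.
rewrite (prod_squarefree_parts a_neq0 g_gt0 c_sf gc a_sf k_ge2) /= -pmulrn.
rewrite prodrXl prodrXr expnMn natrM -!exprM mulrAC; congr (_ * _).
apply: (canRL (mulfK _)); first by rewrite expf_neq0.
by rewrite -expnM natrX -exprD; congr (_ ^+ _); rewrite -hj addnC [(_ * 2)%N]mulnC.
Qed.

Definition set_index (i : 'I_k) (x : bool) A : G := [ffun j => if j == i then x else A j].

Lemma set_index_id i A : set_index i (A i) A = A.
Proof. by apply/ffunP => j; rewrite ffunE; case: eqP => [->|]. Qed.

(** All generators are halved and peeled, so a single rational coefficient remains. *)
Lemma discriminant_11 (i0 : 'I_k) : (forall i, (a i %% 4)%Z = 1) ->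
  is_discriminant L ((rad `|(\prod_i a i)%R| ^ (2 ^ (k - 1)))%N%:Z).
Proof.
move=> a1; pose h (s : G) (i : 'I_k) := true.
rewrite -[rad _]mul1n -[1%N]/(2 ^ 0)%N; apply: (@discriminant_of_halvings h 0 i0).
- by move=> i _; have := a1 i; lia.
- by move=> s; apply: integralZ_beta.
- move=> x ix s.
  have := integral2_peel_all r2 mb (U := predT) (h := h) (fun _ _ _ => isT) (fun _ _ _ _ => erefl) (fun i _ => a1 i) s ix.
  rewrite (big_pred1 s) => [|t].
    2: by apply/forallP/eqP => [H|-> i]; [apply/ffunP => i; apply/eqP/H|exact: eqxx].
  rewrite [beta _ _ _]big1 => [|i _]; last by rewrite ffunE andbF.
  exact: integral2_alg.
(* Each generator is halved for [2^(k-1)] vectors, so twice the number of halvings is [k 2^k] and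
   [j = 0]. *)
- rewrite mul0n addn0 /halvings exchange_big big_distrr /=.
  under eq_bigr => i _ do under eq_bigr => s _ do rewrite andbT.
  under eq_bigr => i _ do rewrite sum_index.
  by rewrite sum_nat_const card_ord.
Qed.

(** After peeling only 1 and [r i0] are left, and the quadratic case applies to their
    coefficients. *)
Lemma discriminant_r1 (i0 : 'I_k) : (a i0 %% 4)%Z = 2 \/ (a i0 %% 4)%Z = 3 ->
  (forall i, i != i0 -> (a i %% 4)%Z = 1) ->
  is_discriminant L (((4 * rad `|(\prod_i a i)%R|) ^ (2 ^ (k - 1)))%N%:Z).
Proof.
move=> a0 a1; pose h (s : G) (i : 'I_k) := i != i0.
rewrite -[4%N]/(2 ^ 2)%N; apply: (@discriminant_of_halvings h 2 i0).
- by move=> i /a1; lia.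
- by move=> s; apply: integralZ_beta => // i _; exact: a1.
- move=> x ix s.
  have := integral2_peel_all r2 mb (U := fun i => i != i0) (h := h) (fun _ _ => id) (fun _ _ _ _ => erefl) a1 s ix.
  have bE t : beta r h [ffun i => t i && ~~ (i != i0)] = r i0 ^+ t i0.
    rewrite /beta (bigD1 i0) //= big1 ?mulr1 => [|i ii0]; last by rewrite ffunE ii0 andbF.
    by rewrite ffunE /theta /h eqxx andbT.
  have agree t y : [forall i, (i != i0) ==> (t i == s i)] && (t i0 == y) = (t == set_index i0 y s).
    apply/andP/eqP => [[/forallP H /eqP ty]|->].
      apply/ffunP => i; rewrite ffunE; case: eqVneq => [->//|ii]; apply/eqP.
      by have := H i; rewrite ii.
    split; last by rewrite ffunE eqxx.
    by apply/forallP => i; apply/implyP => ii; rewrite ffunE (negbTE ii).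
  rewrite (bigID (fun t : G => t i0)) /=.
  rewrite (big_pred1 (set_index i0 true s)) => [|t]; last by rewrite /= -agree eqb_id.
  rewrite (big_pred1 (set_index i0 false s)) => [|t]; last by rewrite /= -agree eqbF_neg.
  rewrite !bE !ffunE eqxx expr1 expr0 addrC.
  have [f fr] := exists_flip r2 mb i0.
  have fi : f (r i0) = - r i0 by rewrite fr eqxx mulN1r.
  move/(integral2_quadratic (r2 i0) fi a0) => [c0 c1].
  by rewrite -(set_index_id i0 s); case: (s i0).
(* Only [k - 1] generators are halved; the missing one accounts for [2^k], twice the unit
   [2^(k-1)]. *)
- rewrite /halvings exchange_big /= (bigD1 i0) //= big1 => [|s _]; last by rewrite /h eqxx andbF.
  rewrite add0n (eq_bigr (fun=> 2 ^ (k - 1))%N) => [|i ii].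
    rewrite sum_nat_const (eq_card (_ : _ =i predC1 i0)) // cardC1 card_ord.
    have -> : (2 ^ k = 2 * 2 ^ (k - 1))%N by rewrite -expnS; congr expn; lia.
    by case: k k_ge2 => // k' _; lia.
  apply/eqP; rewrite -(eqn_pmul2l (isT : 0 < 2)%N) -expnS subn1 prednK ?(ltnW k_ge2) //.
  by rewrite -(sum_index i); apply/eqP; congr muln; apply: eq_bigr => s _; rewrite /h ii andbT.
Qed.

(** [r i0] is never halved and [r i1] only next to [r i0], so after peeling the basis is 1, [r i1],
    [r i0] and [r i0 (1 + r i1) / 2]. *)
Lemma discriminant_23 (i0 i1 : 'I_k) : i0 != i1 ->
  (a i0 %% 4)%Z = 2 -> (a i1 %% 4)%Z = 3 ->
  (forall i, i != i0 -> i != i1 -> (a i %% 4)%Z = 1) ->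
  is_discriminant L (((8 * rad `|(\prod_i a i)%R|) ^ (2 ^ (k - 1)))%N%:Z).
Proof.
move=> i01 a0 a1 aU.
pose h (s : G) (i : 'I_k) := if i == i0 then false else if i == i1 then s i0 else true.
pose U i := (i != i0) && (i != i1).
have i10 : i1 != i0 by rewrite eq_sym.
have h0 s : h s i0 = false by rewrite /h eqxx.
have h1 s : h s i1 = s i0 by rewrite /h (negbTE i10) eqxx.
have hU s i : U i -> h s i by rewrite /h => /andP[/negbTE -> /negbTE ->].
have hloc s t : (forall i, ~~ U i -> s i = t i) -> h s =1 h t.
  move=> st i; rewrite /h; case: eqP => // _; case: eqP => // _; apply: st.
  by rewrite /U eqxx.
have aU' i : U i -> (a i %% 4)%Z = 1 by move=> /andP[]; exact: aU.
have [f0 fr0] := exists_flip r2 mb i0; have [f1 fr1] := exists_flip r2 mb i1.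
have f00 : f0 (r i0) = - r i0 by rewrite fr0 eqxx mulN1r.
have f01 : f0 (r i1) = r i1 by rewrite fr0 (negbTE i10) mul1r.
have f10 : f1 (r i0) = r i0 by rewrite fr1 (negbTE i01) mul1r.
have f11 : f1 (r i1) = - r i1 by rewrite fr1 eqxx mulN1r.
have rint i : integralZ L (r i) by exact: (integralZ_root r2).
have split01 s : beta r h s = r i0 ^+ s i0 * theta r h s i1 ^+ s i1 *
    \prod_(i | U i) (theta r h s i) ^+ s i.
  rewrite /beta (bigD1 i0) //= (bigD1 i1) //= mulrA /theta h0.
  by congr (_ * _); apply: eq_bigl => i.
rewrite -[8%N]/(2 ^ 3)%N; apply: (@discriminant_of_halvings h 3 i0).
- by move=> i ii; have [->|ij] := eqVneq i i1; [|have := aU i ii ij]; lia.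
- move=> s; rewrite split01; apply: integral_mul.
    rewrite /theta h1; case: (s i0); case: (s i1); rewrite ?expr0 ?expr1 ?mulr1 ?mul1r //; last exact: integral1.
    exact: integralZ_mul_half (r2 i0) (r2 i1) a0 a1.
  apply: big_ind => [||i Ui]; [exact: integral1|exact: integral_mul|].
  case: (s i); rewrite ?expr0 ?expr1; last exact: integral1.
  by rewrite /theta hU //; exact: integralZ_half (r2 i) (aU' i Ui).
- move=> x ix s; have := integral2_peel_all r2 mb hU hloc aU' s ix.
  have bE t : beta r h [ffun i => t i && ~~ U i] = r i0 ^+ t i0 *
      (if t i0 then 2^-1 *: (1 + r i1) else r i1) ^+ t i1.
    rewrite split01 [X in _ * X]big1 ?mulr1 => [|i Ui]; last by rewrite ffunE Ui andbF.
    by rewrite /theta h1 !ffunE /U !eqxx !andbF !andbT.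
  have agree t y z : [forall i, U i ==> (t i == s i)] && (t i0 == y) && (t i1 == z) =
      (t == set_index i0 y (set_index i1 z s)).
    apply/andP/eqP => [[/andP[/forallP H /eqP ty] /eqP tz]|->].
      apply/ffunP => i; rewrite !ffunE; case: eqVneq => [->//|ii0]; case: eqVneq => [->//|ii1].
      by apply/eqP; have := H i; rewrite /U ii0 ii1.
    split; last by rewrite !ffunE (negbTE i10) eqxx.
    apply/andP; split; last by rewrite ffunE eqxx.
    by apply/forallP => i; apply/implyP => /andP[ii0 ii1]; rewrite !ffunE (negbTE ii0) (negbTE ii1).
  rewrite (bigID (fun t : G => t i0)) /= (bigID (fun t : G => t i1)) /=.
  rewrite [X in _ + X](bigID (fun t : G => t i1)) /=.
  rewrite (big_pred1 (set_index i0 true (set_index i1 true s))) => [|t]; last by rewrite /= -agree !eqb_id.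
  rewrite (big_pred1 (set_index i0 true (set_index i1 false s))) => [|t]; last by rewrite /= -agree eqb_id eqbF_neg.
  rewrite (big_pred1 (set_index i0 false (set_index i1 true s))) => [|t]; last by rewrite /= -agree eqb_id eqbF_neg.
  rewrite (big_pred1 (set_index i0 false (set_index i1 false s))) => [|t]; last by rewrite /= -agree !eqbF_neg.
  rewrite !bE !ffunE !eqxx (negbTE i10) !expr1 !expr0 !mulr1 !mul1r.
  set c11 := coeff _ _ _; set c10 := coeff _ _ _; set c01 := coeff _ _ _; set c00 := coeff _ _ _.
  (* In the notation of [integral2_biquadratic], [z1 = c11 / 2] and [z0 = c10 + c11 / 2], so its
     conclusions on [z0 - z1] and [2 * z1] concern [c10] and [c11]. *)
  have -> : c11 *: (r i0 * (2^-1 *: (1 + r i1))) + c10 *: r i0 + (c01 *: r i1 + c00 *: 1) =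
      c00%:A + c01 *: r i1 + (c10 + c11 * 2^-1) *: r i0 + (c11 * 2^-1) *: (r i0 * r i1).
    have [j sc] := scale_rmorph L.
    rewrite !sc !(rmorphD, rmorphM).
    by generalize (j c00) (j c01) (j c10) (j c11) (j 2^-1) => *; ring.
  case/(integral2_biquadratic (r2 i0) (r2 i1) f00 f01 f10 f11 a0 a1) => C00 C01.
  rewrite addrK mulrC divfK // => C10 C11.
  have -> : s = set_index i0 (s i0) (set_index i1 (s i1) s) by rewrite !set_index_id.
  by case: (s i0); case: (s i1).
(* [i0] misses its whole share [2^k]; [i1], halved for a quarter of the vectors, misses half of its
   share: together [3 * 2^(k-1)]. *)
- rewrite /halvings exchange_big /= (bigD1 i0) //= big1 => [|s _]; last by rewrite h0 andbF.
  rewrite add0n (bigD1 i1) //=.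
  rewrite (eq_bigr (fun s : G => s i1 && s i0 : nat)) => [|s _]; last by rewrite h1.
  have Si i : (i != i0) && (i != i1) -> (\sum_(s : G) (s i && h s i) = 2 ^ (k - 1))%N.
    move=> Ui; apply/eqP; rewrite -(eqn_pmul2l (isT : 0 < 2)%N) -expnS subn1 prednK ?(ltnW k_ge2) //.
    rewrite -(sum_index i); apply/eqP; congr muln; apply: eq_bigr => s _.
    by rewrite hU ?andbT.
  rewrite (eq_bigr _ Si).
  rewrite sum_nat_const (eq_card (_ : _ =i [predD1 predC1 i0 & i1])) => [|i]; last by rewrite !inE andbC.
  have := sum_index2 i10; have := cardD1 i1 (predC1 i0); rewrite cardC1 card_ord inE /= i10.
  have -> : (2 ^ k = 2 * 2 ^ (k - 1))%N by rewrite -expnS; congr expn; lia.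
  move: #|_| (2 ^ (k - 1))%N (\sum_s _)%N => u v w.
  by case: k k_ge2 => // k' _ /=; rewrite add1n => E1 E2; nia.
Qed.

End DiscriminantTypes.

(** * Presentations *)

Lemma adjoinQ_closed s : divring_closed [in adjoinQ s].
Proof.
split=> [|x y|x y].
- by rewrite inE => M [] [+ _ _] _; rewrite inE.
- rewrite !inE => xs ys M sM; have [[_ Mb _] _] := sM.
  by have := Mb x y; rewrite !inE; apply; [exact: xs|exact: ys].
- rewrite !inE => xs ys M sM; have [[_ _ Mb] _] := sM.
  by have := Mb x y; rewrite !inE; apply; [exact: xs|exact: ys].
Qed.

Lemma adjoinQ_gen s x : x \in s -> adjoinQ s x.
Proof. by move=> xs; apply: sub_gen_smallest. Qed.

Lemma adjoinQ_div s x y : adjoinQ s x -> adjoinQ s y -> adjoinQ s (x / y).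
Proof. by have [_ _ H] := adjoinQ_closed s; have := H x y; rewrite !inE. Qed.

Lemma adjoinQ_sub s x y : adjoinQ s x -> adjoinQ s y -> adjoinQ s (x - y).
Proof. by have [_ H _] := adjoinQ_closed s; have := H x y; rewrite !inE. Qed.

Lemma adjoinQ1 s : adjoinQ s 1.
Proof. by have [H _ _] := adjoinQ_closed s; move: H; rewrite inE. Qed.

Lemma adjoinQN s x : adjoinQ s x -> adjoinQ s (- x).
Proof.
by move=> sx; rewrite -sub0r; apply: adjoinQ_sub => //; rewrite -(subrr 1); apply: adjoinQ_sub; exact: adjoinQ1.
Qed.

Lemma adjoinQM s x y : adjoinQ s x -> adjoinQ s y -> adjoinQ s (x * y).
Proof.
move=> sx sy; rewrite -[y]invrK; apply: adjoinQ_div => //.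
by rewrite -[y^-1]mul1r; apply: adjoinQ_div => //; exact: adjoinQ1.
Qed.

Lemma adjoinQ_nat s n : adjoinQ s n%:R.
Proof.
elim: n => [|n IH]; first by rewrite mulr0n -(subrr 1); apply: adjoinQ_sub; exact: adjoinQ1.
by rewrite -natr1 -[X in _ + X]opprK; apply: adjoinQ_sub => //; apply: adjoinQN; exact: adjoinQ1.
Qed.

Lemma adjoinQ_subset s s' : (forall x, x \in s -> adjoinQ s' x) -> adjoinQ s `<=` adjoinQ s'.
Proof. by move=> ss; apply: smallest_sub => //; exact: adjoinQ_closed. Qed.

Section Presentation.
Variables (k : nat) (K : set algC) (a : k.-tuple int).
Hypothesis pres : presentation K a.
Local Notation G := {ffun 'I_k -> bool}.

Lemma presentation_squarefree i : squarefree `|tnth a i|%N.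
Proof. by case: pres => sf _ _; exact: sf. Qed.

Lemma presentation_neq0 i : tnth a i != 0.
Proof. by rewrite -absz_gt0; exact: squarefree_gt0 (@presentation_squarefree i). Qed.

(** The span of the monomials is closed under products and finite-dimensional, hence a subfield. Its
    image contains the generators of [K], so it contains [K]. *)
Lemma presentation_span (L : fieldExtType rat) (f : {rmorphism L -> algC}) (r : 'I_k -> L) :
  range f = K -> (forall i, f (r i) = sqrtC (tnth a i)%:~R) ->
  (forall i, r i ^+ 2 = (tnth a i)%:~R) ->
  forall x, exists c : G -> rat, x = \sum_s c s *: mono r s.
Proof.
move=> fK fr r2; pose W := <<family_tuple (mono r)>>%VS.
have mW s : mono r s \in W.
  by apply: memv_span; apply/tnthP; exists (enum_rank s); rewrite tnth_mktuple enum_rankK.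
have WE x : x \in W -> exists c : G -> rat, x = \sum_s c s *: mono r s.
  move=> /coord_span xE; exists (fun s => coeff (mono r) s x); rewrite {1}xE [RHS]big_enum_val /=.
  by apply: eq_bigr => i _; rewrite family_tupleE /coeff enum_valK.
have W1 : 1 \in W by rewrite -(mono0 r).
have WW : is_aspace W.
  apply/andP; split; first by apply: has_algid1.
  apply/prodvP => u v /WE[c ->] /WE[d ->].
  rewrite mulr_suml; apply: memv_suml => s _; rewrite mulr_sumr; apply: memv_suml => t _.
  by rewrite -scalerAl -scalerAr (monoM r2); do !apply: memvZ.
pose A : {subfield L} := ASpace WW.
have KW : K `<=` f @` [set x | x \in W].
  case: pres => _ -> _; apply: smallest_sub.
    split=> [|x y|x y]; rewrite ?inE.
    - by exists 1 => //=; rewrite rmorph1.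
    - by move=> [u /= uW <-] [v /= vW <-]; exists (u - v); rewrite ?rmorphB //=; exact: memvB.
    - move=> [u /= uW <-] [v /= vW <-]; exists (u / v); rewrite ?fmorph_div //=.
      by apply: (@memvM _ _ A) => //; rewrite (memvV A).
  move=> _ /= /mapP[z /tnthP[i ->] ->]; exists (r i); last exact: fr.
  by rewrite /= -mono_unit.
move=> x; apply: WE.
have /KW[y /= yW fyx] : K (f x) by rewrite -fK; exists x.
by rewrite -(fmorph_inj f fyx).
Qed.

(** The degree is known only for the extension [M] given by [has_degree], where a spanning family of
    [2 ^ k] elements is a basis. Both embeddings send corresponding monomials to the same number, so
    freeness passes from [M] to [L]. *)
Lemma presentation_basis (L : fieldExtType rat) (f : {rmorphism L -> algC}) :
  range f = K -> exists r : 'I_k -> L,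
    [/\ forall i, f (r i) = sqrtC (tnth a i)%:~R,
        forall i, r i ^+ 2 = (tnth a i)%:~R &
        basis_of {:L} (family_tuple (mono r))].
Proof.
have roots (M : fieldExtType rat) (e : {rmorphism M -> algC}) : range e = K ->
    exists r : 'I_k -> M, (forall i, e (r i) = sqrtC (tnth a i)%:~R) /\
      (forall i, r i ^+ 2 = (tnth a i)%:~R).
  move=> eK; have /choice[r rE] : forall i, exists x, e x = sqrtC (tnth a i)%:~R.
    move=> i; have : K (sqrtC (tnth a i)%:~R).
      by case: pres => _ -> _; apply: adjoinQ_gen; apply/mapP; exists (tnth a i) => //; exact: mem_tnth.
    by rewrite -eK => -[x _ <-]; exists x.
  exists r; split=> // i; apply: (fmorph_inj e).
  by rewrite rmorphXn /= rE sqrtCK rmorph_int.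
case: (pres) => _ _ [M [e [eK dM]]] fK.
have [r [fr r2]] := roots L f fK; have [r' [er' r2']] := roots M e eK.
exists r; split=> //.
have mb' : basis_of {:M} (family_tuple (mono r')).
  by apply: family_basis; [rewrite dM card_indices|exact: presentation_span eK er' r2'].
have em s : f (mono r s) = e (mono r' s).
  by rewrite !rmorph_prod; apply: eq_bigr => i _; rewrite !rmorphXn /= fr er'.
rewrite /basis_of; apply/andP; split.
  apply/eqP/vspaceP => x; rewrite memvf; have [c ->] := presentation_span fK fr r2 x.
  apply: memv_suml => s _; apply: memvZ; apply: memv_span; apply/tnthP.
  by exists (enum_rank s); rewrite tnth_mktuple enum_rankK.
apply/freeP => c c0 i; pose d s := c (enum_rank s).
have E (N : fieldExtType rat) (u : 'I_k -> N) :
    \sum_s d s *: mono u s = \sum_(i < #|{: G}|) c i *: (family_tuple (mono u))`_i.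
  by rewrite big_enum_val /=; apply: eq_bigr => j _; rewrite family_tupleE /d enum_valK.
have d0 : \sum_s d s *: mono r' s = 0.
  apply: (fmorph_inj e); rewrite rmorph0 -(rmorph0 f) -c0 -E !rmorph_sum.
  by apply: eq_bigr => s _; rewrite !rmorphZ_num em.
have := coeff_comb d (enum_val i) mb'; rewrite d0 /coeff linear0 /d enum_valK => <-.
by [].
Qed.

(** [disc] chooses among the discriminants of all extensions with image [K], so [d] is required to
    be the discriminant of each of them. *)
Lemma presentation_disc (d : int) :
  (forall (L : fieldExtType rat) (r : 'I_k -> L), (forall i, r i ^+ 2 = (tnth a i)%:~R) ->
     basis_of {:L} (family_tuple (mono r)) -> is_discriminant L d) -> disc K = d.
Proof.
move=> H; apply: xget_unique.
  case: (pres) => _ _ [L [f [fK _]]]; exists L, f; split=> //.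
  by have [r [_ r2 rb]] := presentation_basis fK; exact: H r2 rb.
move=> d' [L [f [fK dL]]]; apply: discriminant_unique dL _.
by have [r [_ r2 rb]] := presentation_basis fK; exact: H r2 rb.
Qed.

(** Every flip sends the square root [x] to [x] or [-x]. Two monomials occurring in [x] would be
    separated by some flip, so [x] is a multiple of a single one. *)
Lemma sqrt_in_field (c : int) : c != 0 -> K (sqrtC c%:~R) ->
  exists (q : rat) (s : G), c%:~R = q ^+ 2 * (radicand (tnth a) s)%:~R :> rat.
Proof.
move=> c0 Kc; case: (pres) => _ _ [L [f [fK _]]].
have [r [_ r2 rb]] := presentation_basis fK.
have [x fx] : exists x, f x = sqrtC c%:~R by move: Kc; rewrite -fK => -[x _ <-]; exists x.
have x2 : x ^+ 2 = c%:~R.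
  by apply: (fmorph_inj f); rewrite rmorphXn /= fx sqrtCK rmorph_int.
have x0 : x != 0 by apply/eqP => x0; move/eqP: x2; rewrite x0 expr0n eq_sym fieldExt_intr_eq0 (negbTE c0).
have [s sx] : exists s, coeff (mono r) s x != 0.
  apply/existsP; apply: contraNT x0 => /existsPn nx; rewrite (coeffK x rb) big1 // => s _.
  by move: (nx s); rewrite negbK => /eqP ->; rewrite scale0r.
have only t : t != s -> coeff (mono r) t x = 0.
  move=> ts; have [i tsi] : exists i, t i != s i.
    apply/existsP; apply: contraNT ts => /existsPn E; apply/eqP/ffunP => i.
    by apply/eqP; move: (E i); rewrite negbK.
  have [g gr] := exists_flip r2 rb i.
  have : g x = x \/ g x = - x.
    have : (g x == x) || (g x == - x) by rewrite -eqf_sqr -rmorphXn /= x2 rmorph_int.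
    by case/orP => /eqP; [left|right].
  have ct := flip_coeff rb t x gr; have cs := flip_coeff rb s x gr.
  have half (y : rat) : y = - y -> y = 0 by move=> yy; lra.
  case=> gx; rewrite gx in ct cs; move: ct cs tsi sx.
    case: (t i); case: (s i); rewrite ?expr0 ?expr1 ?mul1r ?mulN1r // => ct cs _; first by move=> _; exact: half.
    by rewrite (half _ cs) eqxx.
  rewrite -!scaleN1r !coeffZ; case: (t i); case: (s i); rewrite ?expr0 ?expr1 ?mul1r ?mulN1r // => ct cs _.
    by rewrite (half _ (esym cs)) eqxx.
  by move=> _; exact: half (esym ct).
have xE : x = coeff (mono r) s x *: mono r s.
  by rewrite {1}(coeffK x rb) (bigD1 s) //= big1 ?addr0 // => t /only ->; rewrite scale0r.
exists (coeff (mono r) s x), s.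
move: x2; rewrite xE exprZn (mono_sqr r2) -[(radicand _ _)%:~R]scaler_int -[c%:~R]scaler_int scalerA.
move/eqP; rewrite -subr_eq0 -scalerBl scaler_eq0 oner_eq0 orbF subr_eq0 => /eqP <-.
by rewrite {1}xE coeffZ coeff_basis // eqxx mulr1.
Qed.

(** Otherwise [p] would not divide the radicand in [c = q^2 radicand], so it would divide the
    numerator of [q], and [p^2] would divide [c]. *)
Lemma prime_dvd_presentation (c : int) (p : nat) : prime p -> squarefree `|c|%N ->
  K (sqrtC c%:~R) -> (p %| `|c|)%N -> (p %| `|(\prod_(z <- a) z)%R|)%N.
Proof.
move=> pp csf Kc pc.
have c0 : c != 0 by rewrite -absz_gt0 squarefree_gt0.
have [q [s qs]] := sqrt_in_field c0 Kc; apply: contraT => npa.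
have npr : ~~ (p %| `|radicand (tnth a) s|)%N.
  apply: contra npa; rewrite /radicand big_tuple !(big_morph _ abszM (erefl : absz 1 = 1%N)).
  rewrite !Euclid_dvd_prod // !big_orE => /existsP[i /= pi]; apply/existsP; exists i => /=.
  by move: pi; rewrite abszX; case: (s i); rewrite ?expn1 // expn0 Euclid_dvd1.
have : c * denq q ^+ 2 = numq q ^+ 2 * radicand (tnth a) s.
  by apply: (@intr_inj rat); rewrite !intrM qs -rat_fracE; ring.
move/(congr1 absz); rewrite abszM [in RHS]abszM !abszX => E.
have pn : (p %| `|numq q|)%N.
  have : (p %| `|numq q| ^ 2 * `|radicand (tnth a) s|)%N by rewrite -E dvdn_mulr.
  by rewrite Euclid_dvdM // (negbTE npr) orbF Euclid_dvdX // => /andP[].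
have pd : ~~ (p %| `|denq q|)%N.
  apply/negP => pd; have := coprime_num_den q; rewrite /coprime => /eqP g1.
  have : (p %| gcdn `|numq q| `|denq q|)%N by rewrite dvdn_gcd pn.
  by rewrite g1 Euclid_dvd1.
have : (p ^ 2 %| `|c| * `|denq q| ^ 2)%N by rewrite E dvdn_mulr // dvdn_exp2r.
rewrite Gauss_dvdl ?coprimeXl ?coprimeXr //; last by rewrite prime_coprime.
by move=> /csf p1; rewrite p1 in pp.
Qed.

End Presentation.

(** [rs_fields] allows one presentation for the residue classes and another for the radical; this
    reconciles them. *)
Lemma presentation_rad k K (a b : k.-tuple int) : presentation K a -> presentation K b ->
  rad `|(\prod_(z <- a) z)%R| = rad `|(\prod_(z <- b) z)%R|.
Proof.
have prod0 (c : k.-tuple int) : presentation K c -> (0 < `|(\prod_(z <- c) z)%R|)%N.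
  by move=> pc; rewrite absz_gt0 big_tuple; apply/prodf_neq0 => i _; exact: presentation_neq0 pc i.
have key (c d : k.-tuple int) p : presentation K c -> presentation K d ->
    p \in primes `|(\prod_(z <- c) z)%R| -> p \in primes `|(\prod_(z <- d) z)%R|.
  move=> pc pd; rewrite !mem_primes !prod0 // => /and3P[pp _]; rewrite pp /=.
  have -> : `|(\prod_(z <- c) z)%R|%N = (\prod_i `|tnth c i|)%N.
    by rewrite big_tuple (big_morph _ abszM (erefl : absz 1 = 1%N)).
  rewrite Euclid_dvd_prod // big_orE => /existsP[i /= pi].
  apply: (prime_dvd_presentation pd pp _ _ pi); first exact: presentation_squarefree pc i.
  case: (pc) => _ -> _; apply: adjoinQ_gen; apply/mapP; exists (tnth c i) => //; exact: mem_tnth.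
move=> pa pb; rewrite /rad; congr (\prod_(p <- _) p)%N.
by apply/eq_primes => p; apply/idP/idP; exact: key.
Qed.

(** * Normal forms *)

Lemma squarefree_mod4 (z : int) : squarefree `|z|%N ->
  [\/ (z %% 4)%Z = 1, (z %% 4)%Z = 2 | (z %% 4)%Z = 3].
Proof.
move=> sf; have : ~ (4 %| `|z|)%N by move/(sf 2%N).
move=> n4; have {n4} : (z %% 4)%Z <> 0 by lia.
have := modz_ge0 z (isT : 4 != 0 :> int); have := ltz_pmod z (isT : 0 < 4 :> int).
move: (z %% 4)%Z => m m4 m0 n0; have : m = 1 \/ m = 2 \/ m = 3 by lia.
by case=> [|[]] ->; [constructor 1|constructor 2|constructor 3].
Qed.

(** The product [x y] is 4 times an odd number, so 2 does not divide its squarefree part. *)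
Lemma sqr_mul_odd (x y c : int) (g : nat) : (x %% 4)%Z = 2 -> (y %% 4)%Z = 2 ->
  squarefree `|c|%N -> x * y = g%:Z ^+ 2 * c -> odd `|c|%N.
Proof.
move=> x2 y2 csf E; apply: contraT => ec.
have [x' xE] : exists t, x = 4 * t + 2 by exists (x %/ 4)%Z; lia.
have [y' yE] : exists t, y = 4 * t + 2 by exists (y %/ 4)%Z; lia.
have [c' cE] : exists t, c = 4 * t + 2.
  have c4 : ~ (4 %| `|c|)%N by move/(csf 2%N).
  by exists (c %/ 4)%Z; lia.
have [g' [gE|gE]] : exists g', g%:Z = 2 * g' \/ g%:Z = 2 * g' + 1 by exists (g%:Z %/ 2)%Z; lia.
all: move: E; rewrite gE xE yE cE => E; lia.
Qed.

(** Here [x y = 1] modulo 4, so [g] is odd and [g^2 = 1] modulo 4. *)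
Lemma sqr_mul_mod4 (x y c : int) (g : nat) : (x %% 4)%Z = 3 -> (y %% 4)%Z = 3 ->
  x * y = g%:Z ^+ 2 * c -> (c %% 4)%Z = 1.
Proof.
move=> x3 y3 E.
have [x' xE] : exists t, x = 4 * t + 3 by exists (x %/ 4)%Z; lia.
have [y' yE] : exists t, y = 4 * t + 3 by exists (y %/ 4)%Z; lia.
have [g' [gE|gE]] : exists g', g%:Z = 2 * g' \/ g%:Z = 2 * g' + 1 by exists (g%:Z %/ 2)%Z; lia.
all: move: E; rewrite gE xE yE => E; lia.
Qed.

(** [sqrtC] is multiplicative only up to sign, so identities between square roots are checked on
    squares. *)
Lemma adjoinQ_sqrt s (x y : algC) : x ^+ 2 = y ^+ 2 -> adjoinQ s y -> adjoinQ s x.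
Proof.
move=> /eqP; rewrite eqf_sqr => /orP[/eqP -> //|/eqP ->]; exact: adjoinQN.
Qed.

Section NormalForm.
Variables (k : nat) (K : set algC).
Implicit Types a b : k.-tuple int.
Local Notation sqrts a := [seq sqrtC (z%:~R : algC) | z <- a].

Lemma mem_sqrts a i : adjoinQ (sqrts a) (sqrtC (tnth a i)%:~R).
Proof. by apply: adjoinQ_gen; apply/mapP; exists (tnth a i) => //; exact: mem_tnth. Qed.

Lemma presentation_change a b : presentation K a ->
  (forall i, squarefree `|tnth b i|%N) ->
  (forall i, adjoinQ (sqrts a) (sqrtC (tnth b i)%:~R)) ->
  (forall i, adjoinQ (sqrts b) (sqrtC (tnth a i)%:~R)) -> presentation K b.
Proof.
move=> [_ KE dK] bsf ba ab; split=> //; rewrite KE; apply/seteqP; split.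
  by apply: adjoinQ_subset => x /mapP[z /tnthP[i ->] ->].
by apply: adjoinQ_subset => x /mapP[z /tnthP[i ->] ->].
Qed.

Lemma presentation_swap a (i j : 'I_k) : presentation K a ->
  presentation K [tuple tnth a (tperm i j l) | l < k].
Proof.
move=> pa; apply: (presentation_change pa) => l.
- by rewrite tnth_mktuple; exact: presentation_squarefree pa _.
- by rewrite tnth_mktuple; exact: mem_sqrts.
- have := @mem_sqrts [tuple tnth a (tperm i j l) | l < k] (tperm i j l).
  by rewrite tnth_mktuple tpermK.
Qed.

(* Replace a_i by the squarefree part of a_i a_j for the i in B. *)
Lemma presentation_pivot a (j : 'I_k) (B : pred 'I_k) : presentation K a -> ~~ B j ->
  exists b, [/\ presentation K b, forall i, ~~ B i -> tnth b i = tnth a i &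
    forall i, B i -> exists g : nat, tnth a i * tnth a j = g%:Z ^+ 2 * tnth b i].
Proof.
move=> pa Bj; have a0 i := presentation_neq0 pa i.
have /choice[g /choice[c gc]] : forall i, exists (g : nat) (c : int),
    [/\ (0 < g)%N, squarefree `|c|%N & tnth a i * tnth a j = g%:Z ^+ 2 * c].
  by move=> i; apply: squarefree_decomp; rewrite mulf_neq0.
pose b := [tuple if B i then c i else tnth a i | i < k].
have bE i : tnth b i = if B i then c i else tnth a i by rewrite tnth_mktuple.
have gcC i : (sqrtC (tnth a i)%:~R * sqrtC (tnth a j)%:~R) ^+ 2 =
    ((g i)%:R * sqrtC (c i)%:~R) ^+ 2 :> algC.
  have [_ _ E] := gc i; rewrite !exprMn !sqrtCK -intrM E intrM; congr (_ * _).
  by rewrite rmorphXn.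
have sa0 i : sqrtC (tnth a i)%:~R != 0 :> algC by rewrite sqrtC_eq0 intr_eq0.
have g0 i : (g i)%:R != 0 :> algC by rewrite pnatr_eq0 -lt0n; case: (gc i).
exists b; split=> [|i Bi|i Bi].
- apply: (presentation_change pa) => i; rewrite ?bE.
  + by case: ifP => _; [case: (gc i)|exact: presentation_squarefree pa i].
  + case: ifP => _; last exact: mem_sqrts.
    apply: (@adjoinQ_sqrt _ _ (sqrtC (tnth a i)%:~R * sqrtC (tnth a j)%:~R / (g i)%:R)).
      by rewrite exprMn gcC exprVn !exprMn mulrAC mulfV ?mul1r // expf_neq0.
    by apply: adjoinQ_div; [apply: adjoinQM; exact: mem_sqrts|exact: adjoinQ_nat].
  + have [Bi|Bi] := boolP (B i); last by have := @mem_sqrts b i; rewrite bE (negbTE Bi).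
    apply: (@adjoinQ_sqrt _ _ ((g i)%:R * sqrtC (c i)%:~R / sqrtC (tnth a j)%:~R)).
      by rewrite exprMn -gcC exprVn !exprMn mulfK // expf_neq0.
    apply: adjoinQ_div.
      by apply: adjoinQM; [exact: adjoinQ_nat|have := @mem_sqrts b i; rewrite bE Bi].
    by have := @mem_sqrts b j; rewrite bE (negbTE Bj).
- by rewrite bE (negbTE Bi).
- by exists (g i); rewrite bE Bi; case: (gc i).
Qed.

(** If some entry is 3 modulo 4, it is moved to [i0] and used as pivot for the other such entries,
    which become 1 modulo 4. *)
Lemma presentation_normal_odd a (i0 : 'I_k) : presentation K a -> (forall i, odd `|tnth a i|%N) ->
  exists2 b, presentation K b & (forall i, i != i0 -> (tnth b i %% 4)%Z = 1) /\
    ((tnth b i0 %% 4)%Z = 1 \/ (tnth b i0 %% 4)%Z = 3).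
Proof.
move=> pa ao.
have a13 i : (tnth a i %% 4)%Z = 1 \/ (tnth a i %% 4)%Z = 3.
  by have := ao i; case: (squarefree_mod4 (@presentation_squarefree _ _ _ pa i)); lia.
have [[j aj]|na] := pselect (exists j, (tnth a j %% 4)%Z = 3); last first.
  exists a => //; split=> [i _|]; last exact: a13.
  by case: (a13 i) => // ai; case: na; exists i.
pose b := [tuple tnth a (tperm i0 j l) | l < k].
have pb : presentation K b by exact: presentation_swap.
have b0 : (tnth b i0 %% 4)%Z = 3 by rewrite tnth_mktuple tpermL.
have b13 i : (tnth b i %% 4)%Z = 1 \/ (tnth b i %% 4)%Z = 3 by rewrite tnth_mktuple.
have [|c [pc cE cB]] := @presentation_pivot b i0 [pred i | (i != i0) && (tnth b i %% 4 == 3)%Z] pb.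
  by rewrite /= eqxx.
exists c => //; split=> [i ii|]; last by right; rewrite cE //= eqxx.
have [/eqP bi|bi] := boolP (tnth b i %% 4 == 3)%Z; last first.
  by rewrite cE /= ?ii //; case: (b13 i) => // bi3; rewrite bi3 in bi.
have [|g gE] := cB i; first by rewrite /= ii bi.
exact: sqr_mul_mod4 bi b0 gE.
Qed.

(** An even entry moved to [i0] serves as pivot to make all others odd; if an entry 3 modulo 4
    remains, it is moved to [i1] and clears the other such entries. *)
Lemma presentation_normal_even a (i0 i1 j : 'I_k) : i0 != i1 -> presentation K a ->
  (tnth a j %% 4)%Z = 2 ->
  exists2 b, presentation K b & [/\ (tnth b i0 %% 4)%Z = 2,
    (tnth b i1 %% 4)%Z = 1 \/ (tnth b i1 %% 4)%Z = 3 &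
    forall i, i != i0 -> i != i1 -> (tnth b i %% 4)%Z = 1].
Proof.
move=> i01 pa aj.
pose b := [tuple tnth a (tperm i0 j l) | l < k].
have pb : presentation K b by exact: presentation_swap.
have b0 : (tnth b i0 %% 4)%Z = 2 by rewrite tnth_mktuple tpermL.
have [|c [pc cE cB]] := @presentation_pivot b i0 [pred i | (i != i0) && (tnth b i %% 4 == 2)%Z] pb.
  by rewrite /= eqxx.
have c0 : (tnth c i0 %% 4)%Z = 2 by rewrite cE //= eqxx.
have c13 i : i != i0 -> (tnth c i %% 4)%Z = 1 \/ (tnth c i %% 4)%Z = 3.
  move=> ii; suff : odd `|tnth c i|%N.
    by case: (squarefree_mod4 (@presentation_squarefree _ _ _ pc i)); lia.
  have [/eqP bi|bi] := boolP (tnth b i %% 4 == 2)%Z.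
    have [|g gE] := cB i; first by rewrite /= ii bi.
    exact: sqr_mul_odd bi b0 (@presentation_squarefree _ _ _ pc i) gE.
  rewrite cE /= ?ii //; move: bi.
  by case: (squarefree_mod4 (@presentation_squarefree _ _ _ pb i)); lia.
have [[l [ll cl]]|nc] := pselect (exists l, l != i0 /\ (tnth c l %% 4)%Z = 3); last first.
  have c1 i : i != i0 -> (tnth c i %% 4)%Z = 1.
    by move=> ii; case: (c13 i ii) => // ci; case: nc; exists i.
  by exists c => //; split=> // [|i ii _]; [left; apply: c1; rewrite eq_sym|exact: c1].
pose d := [tuple tnth c (tperm i1 l m) | m < k].
have pd : presentation K d by exact: presentation_swap.
have d0 : tnth d i0 = tnth c i0 by rewrite tnth_mktuple tpermD // eq_sym.
have d1 : (tnth d i1 %% 4)%Z = 3 by rewrite tnth_mktuple tpermL.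
have d13 i : i != i0 -> (tnth d i %% 4)%Z = 1 \/ (tnth d i %% 4)%Z = 3.
  move=> ii; rewrite tnth_mktuple; apply: c13; apply: contra_neq ii => ti.
  by rewrite -(tpermK i1 l i) ti tpermD // eq_sym.
have [|e [pe eE eB]] := @presentation_pivot d i1
    [pred i | (i != i0) && (i != i1) && (tnth d i %% 4 == 3)%Z] pd.
  by rewrite /= eqxx andbF.
exists e => //; split=> [||i ii0 ii1].
- by rewrite eE /= ?eqxx // d0.
- by right; rewrite eE /= ?eqxx ?andbF.
have [/eqP di|di] := boolP (tnth d i %% 4 == 3)%Z.
  have [|g gE] := eB i; first by rewrite /= ii0 ii1 di.
  exact: sqr_mul_mod4 di d1 gE.
rewrite eE /= ?ii0 ?ii1 //; case: (d13 i ii0) => // d3.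
by rewrite d3 in di.
Qed.

Hypothesis k_ge2 : (2 <= k)%N.

Definition rs_shape (r s : int) a : Prop :=
  [/\ (a`_0 = r %[mod 4])%Z, (a`_1 = s %[mod 4])%Z &
      forall i : nat, (2 <= i < k)%N -> (a`_i = 1 %[mod 4])%Z].

Let i0 : 'I_k := Ordinal (ltnW k_ge2).
Let i1 : 'I_k := Ordinal k_ge2.

Lemma rs_shapeP r s a : rs_shape r s a <->
  [/\ (tnth a i0 = r %[mod 4])%Z, (tnth a i1 = s %[mod 4])%Z &
      forall i, i != i0 -> i != i1 -> (tnth a i %% 4)%Z = 1].
Proof.
rewrite !(tnth_nth 0) /=; split=> -[a0 a1 H]; split=> //.
  move=> i ii0 ii1; rewrite (tnth_nth 0); apply: (H i).
  by rewrite ltn_ord andbT; move: ii0 ii1; rewrite -!val_eqE /=; case: (val i) => [|[]].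
move=> i /andP[i2 ik]; have := H (Ordinal ik); rewrite (tnth_nth 0) /=; apply.
  by rewrite -val_eqE /= -lt0n; exact: leq_trans i2.
by rewrite -val_eqE /= neq_ltn i2 orbT.
Qed.

Lemma multiquadratic_shape : multiquadratic k K ->
  [\/ rs_field k 1 1 K, rs_field k 3 1 K, rs_field k 2 1 K | rs_field k 2 3 K].
Proof.
move=> [a pa].
have [[j aj]|na] := pselect (exists j, (tnth a j %% 4)%Z = 2).
  have [//|b pb [b0 [b1|b1] bU]] := @presentation_normal_even a i0 i1 j _ pa aj.
    by constructor 3; exists b => //; apply/rs_shapeP.
  by constructor 4; exists b => //; apply/rs_shapeP.
have [|b pb [bU [b0|b0]]] := @presentation_normal_odd a i0 pa.
- move=> i; case: (squarefree_mod4 (@presentation_squarefree _ _ _ pa i)) => ai; last 2 first.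
  + by case: na; exists i.
  + by lia.
  + by lia.
- by constructor 1; exists b => //; apply/rs_shapeP; split=> // [|i ii _]; apply: bU.
- by constructor 2; exists b => //; apply/rs_shapeP; split=> // [|i ii _]; apply: bU.
Qed.

Lemma disc_11 a : presentation K a -> rs_shape 1 1 a ->
  disc K = (rad `|(\prod_(z <- a) z)%R| ^ (2 ^ (k - 1)))%N%:Z.
Proof.
move=> pa /rs_shapeP[a0 a1 aU]; apply: (presentation_disc pa) => L r r2 rb.
rewrite big_tuple; apply: (discriminant_11 k_ge2 r2 (@presentation_squarefree _ _ _ pa) rb i0).
move=> i; have [->|ii0] := eqVneq i i0; first exact: a0.
by have [->|ii1] := eqVneq i i1; [exact: a1|exact: aU].
Qed.

Lemma disc_r1 r a : (r %% 4)%Z = 2 \/ (r %% 4)%Z = 3 -> presentation K a -> rs_shape r 1 a ->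
  disc K = ((4 * rad `|(\prod_(z <- a) z)%R|) ^ (2 ^ (k - 1)))%N%:Z.
Proof.
move=> r23 pa /rs_shapeP[a0 a1 aU]; apply: (presentation_disc pa) => L rt r2 rb.
rewrite big_tuple; apply: (discriminant_r1 k_ge2 r2 (@presentation_squarefree _ _ _ pa) rb (i0 := i0)).
  by rewrite a0.
by move=> i ii0; have [->|ii1] := eqVneq i i1; [exact: a1|exact: aU].
Qed.

Lemma disc_23 a : presentation K a -> rs_shape 2 3 a ->
  disc K = ((8 * rad `|(\prod_(z <- a) z)%R|) ^ (2 ^ (k - 1)))%N%:Z.
Proof.
move=> pa /rs_shapeP[a0 a1 aU]; apply: (presentation_disc pa) => L r r2 rb.
rewrite big_tuple.
exact: (discriminant_23 k_ge2 r2 (@presentation_squarefree _ _ _ pa) rb (i0 := i0) (i1 := i1)).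
Qed.

Lemma rad_odd_shape r a : (r %% 4)%Z = 1 \/ (r %% 4)%Z = 3 -> rs_shape r 1 a ->
  odd (rad `|(\prod_(z <- a) z)%R|).
Proof.
move=> r13 /rs_shapeP[a0 a1 aU].
have ao i : odd `|tnth a i|%N.
  have [->|ii0] := eqVneq i i0; first by move: a0; lia.
  by have [->|ii1] := eqVneq i i1; [move: a1|have := aU i ii0 ii1]; lia.
rewrite -[odd _]negbK -dvdn2; apply/negP => d2.
have : (0 < logn 2 (rad `|(\prod_(z <- a) z)%R|))%N by rewrite logn_gt0 mem_primes rad_gt0 d2.
rewrite logn_rad mem_primes dvdn2 big_tuple (big_morph _ abszM (erefl : absz 1 = 1%N)).
suff -> : odd (\prod_i `|tnth a i|) by rewrite andbF.
by apply: (big_ind (fun n => odd n)) => // x y ox oy; rewrite oddM ox.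
Qed.

Lemma rad_even_shape s a : presentation K a -> rs_shape 2 s a ->
  exists2 P, odd P /\ squarefree P & rad `|(\prod_(z <- a) z)%R| = (2 * P)%N.
Proof.
move=> pa /rs_shapeP[a0 _ _].
have p0 : \prod_(z <- a) z != 0.
  by rewrite big_tuple; apply/prodf_neq0 => i _; exact: presentation_neq0 pa i.
have d2 : (2 %| rad `|(\prod_(z <- a) z)%R|)%N.
  have : (0 < logn 2 (rad `|(\prod_(z <- a) z)%R|))%N.
    rewrite logn_rad mem_primes /= absz_gt0 p0 big_tuple (bigD1 i0) //= abszM dvdn_mulr //.
    by rewrite dvdn2; move: a0; lia.
  by rewrite logn_gt0 mem_primes => /and3P[].
move: d2 (@squarefree_rad `|(\prod_(z <- a) z)%R|%N) => /dvdnP[P ->] sf.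
exists P; last by rewrite mulnC.
split; last by move=> d dP; apply: sf; exact: dvdn_mulr.
apply: contraT => eP; suff : 2%N = 1%N by [].
by apply: sf; rewrite dvdn_mul // dvdn2.
Qed.

End NormalForm.

(** * Counting *)

Lemma card_setU_disjoint (T : choiceType) (A B : set T) :
  finite_set A -> finite_set B -> (forall x, A x -> B x -> False) ->
  #|` fset_set (A `|` B)|%fset = (#|` fset_set A|%fset + #|` fset_set B|%fset)%N.
Proof.
move=> fA fB AB; rewrite fset_setU // cardfsU.
have -> : (fset_set A `&` fset_set B)%fset = fset0.
  rewrite -fset_setI // [A `&` B](_ : _ = set0) ?fset_set0 //.
  by apply/seteqP; split=> // x [/AB].
by rewrite cardfs0 subn0.
Qed.

Lemma card_bigcup_disjoint (I T : choiceType) (S : set I) (F : I -> set T) :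
  finite_set S -> (forall i, S i -> finite_set (F i)) ->
  (forall i j x, S i -> S j -> F i x -> F j x -> i = j) ->
  #|` fset_set (\bigcup_(i in S) F i)|%fset = \sum_(i \in S) (#|` fset_set (F i)|)%fset.
Proof.
move=> fS fF disj; rewrite fsbig_finite // -bigsetU_fset_set //.
have : all (fun i => i \in S) (fset_set S) by apply/allP => i; rewrite in_fset_set.
have := fset_uniq (fset_set S).
elim: (enum_fset (fset_set S)) => [|i l IH] /=; first by rewrite !big_nil fset_set0.
move=> /andP[il ul] /andP[/set_mem Si Sl]; rewrite !big_cons.
have Sm j : j \in l -> S j by move=> /(allP Sl)/set_mem.
have lE : \big[setU/set0]_(j <- l) F j = \bigcup_(j in [set` l]) F j.
  by rewrite bigcup_seq.
rewrite card_setU_disjoint ?IH //; first exact: fF.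
  by rewrite lE; apply: bigcup_finite => [|j jl]; [exact: finite_seq|exact/fF/Sm].
move=> x Fi; rewrite lE => -[j /= jl Fj].
by move: il; rewrite (disj i j x Si (Sm j jl) Fi Fj) jl.
Qed.

Lemma rs_fieldsP k r s m K : rs_fields k r s m K ->
  exists2 a : k.-tuple int, presentation K a /\ rs_shape r s a &
    rad `|(\prod_(z <- a) z)%R| = m.
Proof.
move=> [[a pa sa] [b pb <-]]; exists a; first by split.
exact: presentation_rad pa pb.
Qed.

Section Counting.
Variables (R : realType) (k : nat) (X : R).
Hypothesis k_ge2 : (2 <= k)%N.
Local Notation N := (2 ^ (k - 1))%N.

Definition bounded_odd (c : nat) : set nat :=
  [set P : nat | [/\ odd P, squarefree P & (((c * P) ^ N)%N)%:R <= X]].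

Lemma finite_bounded_odd c : (0 < c)%N -> finite_set (bounded_odd c).
Proof.
move=> c0; apply: (@sub_finite_set _ _ `I_(Num.bound X)); last exact: finite_II.
move=> P [oP _ PX] /=.
have P0 : (0 < P)%N by apply: odd_gt0.
have N0 : (0 < N)%N by rewrite expn_gt0.
have PE : (P <= (c * P) ^ N)%N.
  apply: (@leq_trans (c * P)); first by rewrite leq_pmull.
  by rewrite -{1}[(c * P)%N]expn1 leq_pexp2l // muln_gt0 c0.
have PX' : P%:R <= X by apply: le_trans PX; rewrite ler_nat.
have X0 : 0 <= X by apply: le_trans PX'; exact: ler0n.
by rewrite -(ltr_nat R); apply: le_lt_trans PX' _; exact: archi_boundP.
Qed.

Lemma rs_fields_disc_11 m K : rs_fields k 1 1 m K -> disc K = (m ^ N)%N%:Z.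
Proof. by move=> /rs_fieldsP[a [pa sa] <-]; exact: disc_11. Qed.

Lemma rs_fields_disc_r1 r m K : (r %% 4)%Z = 2 \/ (r %% 4)%Z = 3 ->
  rs_fields k r 1 m K -> disc K = ((4 * m) ^ N)%N%:Z.
Proof. by move=> r23 /rs_fieldsP[a [pa sa] <-]; exact: disc_r1 pa sa. Qed.

Lemma rs_fields_disc_23 m K : rs_fields k 2 3 m K -> disc K = ((8 * m) ^ N)%N%:Z.
Proof. by move=> /rs_fieldsP[a [pa sa] <-]; exact: disc_23. Qed.

Lemma disc_eq_inj (x y : nat) (d : int) : d = (x ^ N)%N%:Z -> d = (y ^ N)%N%:Z -> x = y.
Proof. by move=> -> [] /eqP; rewrite eqn_exp2r ?expn_gt0 // => /eqP. Qed.

(** The discriminant of a field determines [P], so the union is disjoint. *)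
Lemma card_bounded_type (F : nat -> set (set algC)) c : (0 < c)%N ->
  (forall P, finite_set (F P)) -> (forall P K, F P K -> disc K = ((c * P) ^ N)%N%:Z) ->
  #|` fset_set (\bigcup_(P in bounded_odd c) F P)|%fset =
    \sum_(P \in bounded_odd c) (#|` fset_set (F P)|)%fset.
Proof.
move=> c0 fF dF; apply: card_bigcup_disjoint => // [|P Q K _ _ FP FQ].
  exact: finite_bounded_odd.
apply/eqP; rewrite -(eqn_pmul2l c0); apply/eqP.
exact: disc_eq_inj (dF _ _ FP) (dF _ _ FQ).
Qed.

Lemma bounded_fieldsE : bounded_fields k X =
  (\bigcup_(P in bounded_odd 1) rs_fields k 1 1 P `|`
   \bigcup_(P in bounded_odd 4) rs_fields k 3 1 P) `|`
  \bigcup_(P in bounded_odd 8) rs_fields k 2 1 (2 * P) `|`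
  \bigcup_(P in bounded_odd 16) rs_fields k 2 3 (2 * P).
Proof.
have mq r s m K : rs_fields k r s m K -> multiquadratic k K.
  by move=> [[a pa _] _]; exists a.
have bound (n : nat) K : disc K = n%:Z -> (disc K)%:~R <= X -> n%:R <= X by move=> ->.
have bound' (n : nat) K : disc K = n%:Z -> n%:R <= X -> (disc K)%:~R <= X by move=> ->.
apply/seteqP; split=> K.
  move=> [mK dX]; case: (multiquadratic_shape k_ge2 mK) => rK; have [a pa sa] := rK.
  - left; left; left.
    have FK : rs_fields k 1 1 (rad `|(\prod_(z <- a) z)%R|) K by split=> //; exists a.
    exists (rad `|(\prod_(z <- a) z)%R|) => //; split.
    + by apply: (rad_odd_shape k_ge2 _ sa); left.
    + exact: squarefree_rad.
    + by rewrite mul1n; apply: bound dX; exact: rs_fields_disc_11.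
  - left; left; right.
    have FK : rs_fields k 3 1 (rad `|(\prod_(z <- a) z)%R|) K by split=> //; exists a.
    exists (rad `|(\prod_(z <- a) z)%R|) => //; split.
    + by apply: (rad_odd_shape k_ge2 _ sa); right.
    + exact: squarefree_rad.
    + by apply: bound dX; apply: (rs_fields_disc_r1 _ FK); right.
  - left; right; have [P [oP sP] radP] := rad_even_shape k_ge2 pa sa.
    have FK : rs_fields k 2 1 (2 * P) K by split=> //; exists a.
    exists P => //; split=> //; apply: bound dX.
    (* The radical is [2 * P], so the discriminant constant 4 appears as 8 in front of [P]; likewise
       8 becomes 16 for type (2,3). *)
    by rewrite -[8%N]/(4 * 2)%N -mulnA; apply: (rs_fields_disc_r1 _ FK); left.
  - right; have [P [oP sP] radP] := rad_even_shape k_ge2 pa sa.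
    have FK : rs_fields k 2 3 (2 * P) K by split=> //; exists a.
    exists P => //; split=> //; apply: bound dX.
    by rewrite -[16%N]/(8 * 2)%N -mulnA; apply: (rs_fields_disc_23 FK).
case=> [[[]|]|] [P [oP sP PX] FK]; split; try exact: mq FK.
- by rewrite mul1n in PX; apply: bound' PX; exact: rs_fields_disc_11.
- by apply: bound' PX; apply: (rs_fields_disc_r1 _ FK); right.
- apply: bound' PX; rewrite -[8%N]/(4 * 2)%N -mulnA.
  by apply: (rs_fields_disc_r1 _ FK); left.
- apply: bound' PX; rewrite -[16%N]/(8 * 2)%N -mulnA.
  exact: (rs_fields_disc_23 FK).
Qed.

End Counting.

Theorem theorem14 (R : realType) (k : nat) (X : R) (hk : (2 <= k)%N) (hX : 0 < X) :
  finite_set (bounded_fields k X) /\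
  Nk k X =
    \sum_(P \in [set P : nat | [/\ odd P, squarefree P &
                   ((P ^ (2 ^ (k - 1)))%N)%:R <= X]]) Qk k 1 1 P
  + \sum_(P \in [set P : nat | [/\ odd P, squarefree P &
                   (((4 * P) ^ (2 ^ (k - 1)))%N)%:R <= X]]) Qk k 3 1 P
  + \sum_(P \in [set P : nat | [/\ odd P, squarefree P &
                   (((8 * P) ^ (2 ^ (k - 1)))%N)%:R <= X]]) Qk k 2 1 (2 * P)%N
  + \sum_(P \in [set P : nat | [/\ odd P, squarefree P &
                   (((16 * P) ^ (2 ^ (k - 1)))%N)%:R <= X]]) Qk k 2 3 (2 * P)%N.
Proof.
pose F1 P := rs_fields k 1 1 P; pose F2 P := rs_fields k 3 1 P.
pose F3 P := rs_fields k 2 1 (2 * P)%N; pose F4 P := rs_fields k 2 3 (2 * P)%N.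
have D1 P K : F1 P K -> disc K = ((1 * P) ^ (2 ^ (k - 1)))%N%:Z.
  by rewrite mul1n; exact: rs_fields_disc_11.
have D2 P K : F2 P K -> disc K = ((4 * P) ^ (2 ^ (k - 1)))%N%:Z.
  by apply: rs_fields_disc_r1 => //; right.
have D3 P K : F3 P K -> disc K = ((8 * P) ^ (2 ^ (k - 1)))%N%:Z.
  by rewrite -[8%N]/(4 * 2)%N -mulnA; apply: rs_fields_disc_r1 => //; left.
have D4 P K : F4 P K -> disc K = ((16 * P) ^ (2 ^ (k - 1)))%N%:Z.
  by rewrite -[16%N]/(8 * 2)%N -mulnA; exact: rs_fields_disc_23.
have fin F c : (0 < c)%N -> (forall P, finite_set (F P)) ->
    finite_set (\bigcup_(P in bounded_odd k X c) F P : set (set algC)).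
  by move=> c0 fF; apply: bigcup_finite => //; exact: finite_bounded_odd.
have fF1 := fin F1 1%N isT (fun P => finite_rs_fields k 1 1 P).
have fF2 := fin F2 4%N isT (fun P => finite_rs_fields k 3 1 P).
have fF3 := fin F3 8%N isT (fun P => finite_rs_fields k 2 1 (2 * P)).
have fF4 := fin F4 16%N isT (fun P => finite_rs_fields k 2 3 (2 * P)).
have bE := bounded_fieldsE X hk.
split; first by rewrite bE !finite_setU.
have -> : [set P : nat | [/\ odd P, squarefree P & ((P ^ (2 ^ (k - 1)))%N)%:R <= X]] =
    bounded_odd k X 1.
  by apply/seteqP; split=> P; rewrite /bounded_odd /= mul1n.
(* A field common to two types would give equal discriminants, hence an equality between two of [P],
   [4 P], [8 P], [16 P] taken at odd arguments; their powers of 2 differ. *)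
rewrite /Nk bE card_setU_disjoint ?finite_setU //; last first.
  move=> K [[]|] [P [oP _ _] FK] [Q [oQ _ _] FQ].
  - by have := disc_eq_inj (D1 _ _ FK) (D4 _ _ FQ); lia.
  - by have := disc_eq_inj (D2 _ _ FK) (D4 _ _ FQ); lia.
  - by have := disc_eq_inj (D3 _ _ FK) (D4 _ _ FQ); lia.
rewrite card_setU_disjoint ?finite_setU //; last first.
  move=> K [] [P [oP _ _] FK] [Q [oQ _ _] FQ].
  - by have := disc_eq_inj (D1 _ _ FK) (D3 _ _ FQ); lia.
  - by have := disc_eq_inj (D2 _ _ FK) (D3 _ _ FQ); lia.
rewrite card_setU_disjoint //; last first.
  move=> K [P [oP _ _] FK] [Q [oQ _ _] FQ].
  by have := disc_eq_inj (D1 _ _ FK) (D2 _ _ FQ); lia.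
congr (_ + _ + _ + _)%N; apply: card_bounded_type => // P; exact: finite_rs_fields.
Qed.
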